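(* Fix a finite set $\Sigma$ with $|\Sigma|\geq 2$. For every (finite or infinite) family $\mathcal{F}$ of ordered graphs $F:\binom{[n_F]}{2}\to\Sigma$ and every $\epsilon>0$ there exist an integer $q_0=q_0(\mathcal{F},\epsilon)$ and a real $\delta=\delta(\mathcal{F},\epsilon)>0$ such that every ordered graph $G:\binom{[n]}{2}\to\Sigma$ that is $\epsilon$-far from $\mathcal{F}$-freeness contains at least $\delta n^q$ induced copies of some graph $F\in\mathcal{F}$ on $q\leq q_0$ vertices.
   Context: An ordered graph over $\Sigma$ is a function $G:\binom{V}{2}\to\Sigma$ with $V$ a totally ordered finite set. For $U\subseteq V$ with elements $u_1<\dots<u_k$, the ordered subgraph of $G$ on $U$ is $H:\binom{[k]}{2}\to\Sigma$, $H(ij)=G(u_iu_j)$ for $i<j$. An induced copy of $F:\binom{[q]}{2}\to\Sigma$ in $G$ is a set $U\subseteq V$ of size $q$ whose ordered subgraph equals $F$. $G$ is $\mathcal{F}$-free if no ordered subgraph of $G$ belongs to $\mathcal{F}$. $G:\binom{[n]}{2}\to\Sigma$ is $\epsilon$-far from $\mathcal{F}$-freeness if one must change the value $G(ij)$ for at least $\epsilon\binom{n}{2}$ pairs to make it $\mathcal{F}$-free. *)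

(* Defs.v *)
From mathcomp Require Import all_boot all_order all_algebra.
From mathcomp Require Import reals.

Set Implicit Arguments.
Unset Strict Implicit.
Unset Printing Implicit Defensive.

Import Order.TTheory GRing.Theory Num.Theory.

Definition vpair (n : nat) := {e : {set 'I_n} | #|e| == 2}.

Definition ordgraph (Sigma : finType) (n : nat) := {ffun vpair n -> Sigma}.

Lemma vpair_imset_proof (n : nat) (U : {set 'I_n}) (e : vpair #|U|) :
  #|[set enum_val i | i in val e]| == 2.
Proof. by rewrite card_imset; [exact: (valP e) | exact: enum_val_inj]. Qed.

(* [enum U] lists the elements of U in increasing order, so [enum_val i] is
   the i-th smallest element u_i of U. *)
Definition vpair_imset (n : nat) (U : {set 'I_n}) (e : vpair #|U|) : vpair n :=
  exist _ [set enum_val i | i in val e] (vpair_imset_proof e).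

Definition osubgraph (Sigma : finType) (n : nat) (G : ordgraph Sigma n)
    (U : {set 'I_n}) : ordgraph Sigma #|U| :=
  [ffun e => G (vpair_imset e)].

(* The equality lives in the sigma type of graphs with their order, because
   [osubgraph G U] has type [ordgraph Sigma #|U|]: it says that #|U| = q and
   that, along this equality, the ordered subgraph on U is F. *)
Definition induced_copies (Sigma : finType) (q n : nat)
    (F : ordgraph Sigma q) (G : ordgraph Sigma n) : {set {set 'I_n}} :=
  [set U | Tagged (ordgraph Sigma) (osubgraph G U)
           == Tagged (ordgraph Sigma) F].

Definition graph_family (Sigma : finType) := forall n, ordgraph Sigma n -> Prop.

Definition family_free (Sigma : finType) (Fam : graph_family Sigma)
    (n : nat) (G : ordgraph Sigma n) : Prop :=
  forall U : {set 'I_n}, ~ Fam #|U| (osubgraph G U).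

Definition changed_pairs (Sigma : finType) (n : nat) (G H : ordgraph Sigma n)
    : {set vpair n} :=
  [set e | G e != H e].

(* For eps > 0 and n >= 2 the first conjunct follows from the second one. For
   n <= 1 there are no pairs and the second conjunct always holds; the first
   one keeps graphs that are already free from counting as far. A graph that
   no change can make free is far for every eps. *)
Definition eps_far (R : realType) (Sigma : finType) (Fam : graph_family Sigma)
    (eps : R) (n : nat) (G : ordgraph Sigma n) : Prop :=
  ~ family_free Fam G /\
  forall H : ordgraph Sigma n, family_free Fam H ->
    (eps * 'C(n, 2)%:R <= #|changed_pairs G H|%:R)%R.

(* Main.v *)
Require Import Defs.
From mathcomp Require Import all_boot all_order all_algebra.
From mathcomp Require Import reals.
From mathcomp Require Import ring lra zify.

Set Implicit Arguments.
Unset Strict Implicit.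
Unset Printing Implicit Defensive.

Import Order.TTheory GRing.Theory Num.Theory.
Local Open Scope ring_scope.

(** Proof idea.  Let [G] be far with few copies of the small members of the
    family.  Energy increments give a colouring [c] of the vertices of [G],
    together with a partition into [m.+1] intervals, whose edge densities and
    whose colour frequencies barely change under the refinements
    used here.  The rounded densities take finitely many values, so a
    graph [H] that is also far, has nearly the same densities, and has size
    bounded by a constant [M], exists.  Only then is a cut-regular refinement
    [c'] of [c] chosen, with precision depending on [M].  Map [H] to [G] at
    random and increasingly, every vertex going to its own cell: inside each
    interval of [H] the vertices follow each other in consecutive short slots
    of the corresponding interval of [G], shifted by a random amount, so that
    every single vertex is nearly uniform in its cell.  Recolour a pair of [H]
    whenever its colour has density less than [tau] with respect to [c'] at the
    image pair, using a denser colour instead.  Since [c] is energy-stable, few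
    pairs change on average.  If the result contained a member [F] of the
    family, the product of the corresponding densities would be bounded below,
    whereas the counting lemma and the scarcity of copies of [F] make it tiny on
    average.  Hence some choice repairs [H] cheaply, and [H] was not far.  The
    exact 0/1 information in a limit object, used by Lovasz and Szegedy in the
    unordered case, is replaced by the choice of [c'] after [M]. *)

(** * Conditional expectations and energies *)

Section CondExp.
Context {R : realFieldType} {T : finType}.
Implicit Types f h : T -> R.

Definition cexp (K : finType) (k : T -> K) (f : T -> R) (x : T) : R :=
  (\sum_(y | k y == k x) f y) / #|[pred y | k y == k x]|%:R.

Definition refines (K' K : eqType) (k' : T -> K') (k : T -> K) :=
  forall x y, k' x = k' y -> k x = k y.

Lemma fiber_card_gt0 (K : finType) (k : T -> K) x :
  0 < #|[pred y | k y == k x]|%:R :> R.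
Proof. by rewrite ltr0n; apply/card_gt0P; exists x; rewrite inE. Qed.

Lemma cexp_meas (K : finType) (k : T -> K) f x y :
  k x = k y -> cexp k f x = cexp k f y.
Proof. by rewrite /cexp => ->. Qed.

Lemma cexpM (K : finType) (k : T -> K) f h :
  (forall x y, k x = k y -> h x = h y) ->
  \sum_x cexp k f x * h x = \sum_x f x * h x.
Proof.
move=> hm.
transitivity (\sum_x \sum_(y | k y == k x)
                 f y * h x / #|[pred z | k z == k x]|%:R).
  apply: eq_bigr => x _; rewrite /cexp mulrAC mulr_suml mulr_suml.
  by apply: eq_bigr => y _.
rewrite (exchange_big_dep xpredT) //=; apply: eq_bigr => y _.
transitivity (\sum_(x | k x == k y) f y * h y / #|[pred z | k z == k y]|%:R).
  apply: eq_big => x; first by rewrite eq_sym.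
  by move/eqP=> kxy; rewrite (hm x y) -?kxy.
rewrite sumr_const -[LHS]mulr_natr mulfVK //.
by rewrite (eq_card (B := [pred z | k z == k y])) // gt_eqF // fiber_card_gt0.
Qed.

(** Both sides equal the sum of the products of the two conditional expectations, by [cexpM]. *)
Lemma cexp_adj (K : finType) (k : T -> K) f h :
  \sum_x cexp k f x * h x = \sum_x f x * cexp k h x.
Proof.
rewrite -(@cexpM _ k f (cexp k h)); last by move=> x y; exact: cexp_meas.
rewrite -(eq_bigr _ (fun x _ => mulrC _ _)) -(eq_bigr _ (fun x _ => mulrC (cexp k h x) _)).
by rewrite cexpM // => x y; exact: cexp_meas.
Qed.

Lemma cexp_ge0 (K : finType) (k : T -> K) f x :
  (forall y, 0 <= f y) -> 0 <= cexp k f x.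
Proof. by move=> f0; rewrite divr_ge0 ?ler0n ?sumr_ge0. Qed.

Lemma cexp1 (K : finType) (k : T -> K) f x :
  (forall y, f y = 1) -> cexp k f x = 1.
Proof.
move=> f1; rewrite /cexp (eq_bigr (fun=> 1)) => [|y _]; last exact: f1.
by rewrite sumr_const divff // gt_eqF // fiber_card_gt0.
Qed.

Lemma cexp_sum (K I : finType) (k : T -> K) (f : I -> T -> R) x :
  \sum_i cexp k (f i) x = cexp k (fun y => \sum_i f i y) x.
Proof. by rewrite /cexp -mulr_suml exchange_big. Qed.

Lemma cexp_le (K : finType) (k : T -> K) f h x :
  (forall y, f y <= h y) -> cexp k f x <= cexp k h x.
Proof. by move=> fh; rewrite ler_pM2r ?invr_gt0 ?fiber_card_gt0 // ler_sum. Qed.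

Lemma cexp_le1 (K : finType) (k : T -> K) f x :
  (forall y, f y <= 1) -> cexp k f x <= 1.
Proof. by move=> f1; rewrite -(@cexp1 _ k (fun=> 1) x) //; exact: cexp_le. Qed.

(** Orthogonality: by [cexpM], the product of the fine and the coarse expectation has the same sum
    as the square of the coarse one. *)
Lemma cexp_pythag (K' K : finType) (k' : T -> K') (k : T -> K) f :
  refines k' k ->
  \sum_x (cexp k' f x - cexp k f x) ^+ 2 =
  \sum_x cexp k' f x ^+ 2 - \sum_x cexp k f x ^+ 2.
Proof.
move=> rk.
have E1 : \sum_x cexp k' f x * cexp k f x = \sum_x f x * cexp k f x.
  by apply: cexpM => x y /rk; exact: cexp_meas.
have E2 : \sum_x cexp k f x * cexp k f x = \sum_x f x * cexp k f x.
  by apply: cexpM => x y; exact: cexp_meas.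
have E3 : \sum_x (cexp k' f x - cexp k f x) ^+ 2 =
  \sum_x cexp k' f x ^+ 2 - 2 * (\sum_x cexp k' f x * cexp k f x)
  + \sum_x cexp k f x * cexp k f x.
  rewrite mulr_sumr -sumrB -big_split /=; apply: eq_bigr => x _; ring.
rewrite E3 E1 -E2.
have -> : \sum_x cexp k f x * cexp k f x = \sum_x cexp k f x ^+ 2.
  by apply: eq_bigr => x _.
ring.
Qed.

Definition energy (K : finType) (k : T -> K) (f : T -> R) : R :=
  (\sum_x cexp k f x ^+ 2) / #|T|%:R.

Lemma energyB (K' K : finType) (k' : T -> K') (k : T -> K) f :
  refines k' k ->
  energy k' f - energy k f = (\sum_x (cexp k' f x - cexp k f x) ^+ 2) / #|T|%:R.
Proof. by move=> rk; rewrite cexp_pythag // mulrBl. Qed.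

Lemma energy_mono (K' K : finType) (k' : T -> K') (k : T -> K) f :
  refines k' k -> energy k f <= energy k' f.
Proof.
move=> rk; rewrite -subr_ge0 energyB // divr_ge0 ?ler0n ?sumr_ge0 // => x _.
exact: sqr_ge0.
Qed.

Lemma energy_le1 (K : finType) (k : T -> K) f :
  (forall y, 0 <= f y <= 1) -> energy k f <= 1.
Proof.
move=> f01; rewrite /energy; have [T0|T0] := posnP #|T|.
  by rewrite T0 invr0 mulr0 ler01.
rewrite ler_pdivrMr ?ltr0n // mul1r -sum1_card natr_sum.
apply: ler_sum => x _; rewrite expr_le1 //.
  by apply: cexp_le1 => y; case/andP: (f01 y).
by apply: cexp_ge0 => y; case/andP: (f01 y).
Qed.

(* AM-GM in place of Cauchy-Schwarz. *)
Lemma l1_le_energy (K' K : finType) (k' : T -> K') (k : T -> K) f (a : R) :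
  0 < a -> refines k' k ->
  \sum_x `|cexp k' f x - cexp k f x| <=
  (a + (energy k' f - energy k f) / a) * #|T|%:R.
Proof.
move=> a0 rk; have [T0|T0] := posnP #|T|.
  rewrite T0 mulr0 big1 // => x _.
  by have := card0_eq T0 x; rewrite inE.
rewrite energyB //; set D' := \sum_x _ ^+ 2.
have -> : (a + D' / #|T|%:R / a) * #|T|%:R = a * #|T|%:R + D' / a.
  by field; rewrite gt_eqF //= pnatr_eq0 -lt0n T0.
rewrite /D' -sum1_card natr_sum mulr_sumr mulr_suml -big_split /=.
apply: ler_sum => x _; set t := cexp _ _ _ - _.
rewrite mulr1 -real_normK ?num_real //; set s := `|t|.
rewrite -subr_ge0 (_ : _ - _ = ((a - s) ^+ 2 + a * s) / a); last first.
  by field; rewrite gt_eqF.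
apply: divr_ge0 (ltW a0); apply: addr_ge0; first exact: sqr_ge0.
exact: mulr_ge0 (ltW a0) (normr_ge0 _).
Qed.

End CondExp.

(** * Colour densities of ordered pairs and their energy *)

Section PairColourings.
Context {R : realFieldType} {Sigma V : finType}.
Implicit Types (g : V -> V -> Sigma).

Definition pcol (K : Type) (c : V -> K) (p : V * V) := (c p.1, c p.2).

Definition has_col g (s : Sigma) (p : V * V) : R := (g p.1 p.2 == s)%:R.

Definition dens g (K : finType) (c : V -> K) (s : Sigma) : V * V -> R :=
  cexp (pcol c) (has_col g s).

Definition pair_energy g (K : finType) (c : V -> K) : R :=
  \sum_s energy (pcol c) (has_col g s).

Lemma has_col01 g s p : 0 <= has_col g s p <= 1.
Proof. by rewrite ler0n lern1 leq_b1. Qed.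

Lemma dens_ge0 g (K : finType) (c : V -> K) s p : 0 <= dens g c s p.
Proof. by apply: cexp_ge0 => q; case/andP: (has_col01 g s q). Qed.

Lemma dens_le1 g (K : finType) (c : V -> K) s p : dens g c s p <= 1.
Proof. by apply: cexp_le1 => q; case/andP: (has_col01 g s q). Qed.

Lemma dens_sum g (K : finType) (c : V -> K) p : \sum_s dens g c s p = 1.
Proof.
rewrite /dens cexp_sum; apply: cexp1 => q.
rewrite (bigD1 (g q.1 q.2)) //= /has_col eqxx big1 ?addr0 // => s.
by rewrite eq_sym => /negbTE->.
Qed.

Lemma refines_pcol (K' K : finType) (c' : V -> K') (c : V -> K) :
  refines c' c -> refines (pcol c') (pcol c).
Proof. by move=> rc [x y] [x' y'] [/rc /= ex /rc /= ey]; rewrite /pcol /= ex ey. Qed.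

Lemma pair_energy_mono g (K' K : finType) (c' : V -> K') (c : V -> K) :
  refines c' c -> pair_energy g c <= pair_energy g c'.
Proof. by move=> rc; apply: ler_sum => s _; apply/energy_mono/refines_pcol. Qed.

Lemma pair_energy_le g (K : finType) (c : V -> K) :
  pair_energy g c <= #|Sigma|%:R.
Proof.
rewrite -sum1_card natr_sum; apply: ler_sum => s _.
exact/energy_le1/has_col01.
Qed.

(** Only one sign of the deviation is bounded: [counting] needs just that a colour is not much
    scarcer on a rectangle than its density predicts. *)
Definition cut_regular g (K : finType) (c : V -> K) (eta : R) :=
  forall s (A B : {set V}),
  \sum_(x in A) \sum_(y in B) (dens g c s (x, y) - has_col g s (x, y)) <=
  eta * #|V|%:R ^+ 2.

(** Split every class by the two sides of a violating rectangle. On it the new density has the same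
    sum as the colour itself, so the violation bounds the L2 distance of the two densities from
    below, and this distance is the energy gain. *)
Lemma cut_irregular_energy g (K : finType) (c : V -> K) (eta : R) :
  0 < eta -> ~ cut_regular g c eta ->
  exists A B : {set V},
    pair_energy g c + eta ^+ 2 <= pair_energy g (fun x => (c x, x \in A, x \in B)).
Proof.
move=> e0 nreg.
have [s [A [B lt]]] : exists s (A B : {set V}), eta * #|V|%:R ^+ 2 <
   \sum_(x in A) \sum_(y in B) (dens g c s (x, y) - has_col g s (x, y)).
  apply: boolp.contrapT => H; apply: nreg => s A B; rewrite leNgt; apply/negP => lt.
  by apply: H; exists s, A, B.
exists A, B; set c' := fun x => _.
have rc : refines c' c by move=> x y [].
have [V0|V0] := posnP #|V|.
  move: lt; rewrite V0 expr0n mulr0 big1 ?ltxx // => x _.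
  by have := card0_eq V0 x; rewrite inE.
pose h (p : V * V) : R := ((p.1 \in A) && (p.2 \in B))%:R.
have hc : \sum_p dens g c' s p * h p = \sum_p has_col g s p * h p.
  by apply: cexpM => -[x y] [x' y'] [_ xA _ _ _ yB]; rewrite /h /= xA yB.
have E : \sum_(x in A) \sum_(y in B) (dens g c s (x, y) - has_col g s (x, y)) =
   \sum_p (dens g c s p - dens g c' s p) * h p.
  transitivity (\sum_p (dens g c s p - has_col g s p) * h p).
    rewrite pair_big_dep /= big_mkcond /=; apply: eq_bigr => -[x y] _ /=.
    by rewrite /h /=; case: ifP => _; rewrite ?mulr1 ?mulr0.
  rewrite -(subr0 (\sum_p _)) -[in RHS](subr0 (\sum_p _)).
  under eq_bigr do rewrite mulrBl; under [in RHS]eq_bigr do rewrite mulrBl.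
  by rewrite !sumrB hc.
pose D := \sum_p (dens g c' s p - dens g c s p) ^+ 2.
have Dge : eta ^+ 2 * #|V|%:R ^+ 2 <= D.
  (* AM-GM pair by pair: inside the rectangle the slack is [(t - u + eta) ^+ 2 / (2 * eta)], outside
     it the right side is nonnegative. *)
  have Dle : \sum_p (dens g c s p - dens g c' s p) * h p <=
            D / (2 * eta) + eta / 2 * #|V|%:R ^+ 2.
    rewrite /D mulr_suml.
    have -> : #|V|%:R ^+ 2 = \sum_(p : V * V) 1 :> R.
      by rewrite sumr_const card_prod natrM.
    rewrite mulr_sumr -big_split /=; apply: ler_sum => p _.
    set t := dens g c' s p; set u := dens g c s p.
    have := sqr_ge0 (t - u + eta); have := sqr_ge0 (t - u).
    rewrite mulr1 -subr_ge0; have e0' : eta != 0 by rewrite gt_eqF.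
    rewrite /h; case: (_ && _) => /= h1 h2.
      rewrite (_ : _ - _ = (t - u + eta) ^+ 2 / (2 * eta)); last by field.
      by rewrite divr_ge0 // mulr_ge0 // ltW.
    rewrite mulr0 subr0; apply: addr_ge0; last by apply: divr_ge0 (ltW e0) _.
    by apply: divr_ge0 h1 _; rewrite mulr_ge0 // ltW.
  rewrite E in lt; have H := lt_le_trans lt Dle.
  have {}H : eta / 2 * #|V|%:R ^+ 2 < D / (2 * eta) by move: H; lra.
  rewrite ltr_pdivlMr ?mulr_gt0 // in H; apply: le_trans (ltW H).
  by rewrite le_eqVlt; apply/orP; left; apply/eqP; field.
rewrite /pair_energy (bigD1 s) //= [leRHS](bigD1 s) //= addrAC lerD //; last first.
  by apply: ler_sum => s' _; apply/energy_mono/refines_pcol.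
rewrite -lerBrDl energyB; last exact: refines_pcol.
by rewrite ler_pdivlMr ?card_prod ?natrM -?expr2 ?exprn_gt0 ?ltr0n.
Qed.

End PairColourings.

(** * Cut-regular partitions and counting *)

(** [d] counts the energy increments of [eta ^+ 2] still possible below [#|Sigma|.+1]. The palette
    [K'] is fixed before [V], [g] and [c], since later constants depend on it but not on the
    graph. *)
Lemma cut_regular_aux (R : realFieldType) (Sigma : finType) (eta : R) (d : nat) :
  0 < eta -> forall K : finType, exists K' : finType,
  forall (V : finType) (g : V -> V -> Sigma) (c : V -> K),
    #|Sigma|.+1%:R - d%:R * eta ^+ 2 <= pair_energy g c ->
    exists c' : V -> K', refines c' c /\ cut_regular g c' eta.
Proof.
move=> e0; elim: d => [|d IH] K.
  exists K => V g c; rewrite mul0r subr0 => /le_trans/(_ (pair_energy_le g c)).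
  by rewrite ler_nat ltnn.
have [K1 HK1] := IH (K * bool * bool)%type.
(* Whether the refinement stops here depends on the graph, so the palette offers both outcomes:
   right summand for stopping, left for going on. *)
exists (K1 + K)%type => V g c ge.
have [reg|/(cut_irregular_energy e0)[A [B le]]] := boolp.pselect (cut_regular g c eta).
  exists (fun x => inr (c x)); split; first by move=> x y [].
  move=> s A B; apply: le_trans (reg s A B).
  apply: ler_sum => x _; apply: ler_sum => y _; rewrite lerD2r.
  by rewrite /dens /cexp lexx.
have [|c' [ref reg]] := HK1 V g (fun x => (c x, x \in A, x \in B)).
  by apply: le_trans le; rewrite -lerBlDr; apply: le_trans ge; rewrite -natr1; lra.
exists (fun x => inl (c' x)); split; first by move=> x y [/ref[]].
move=> s C D; apply: le_trans (reg s C D).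
apply: ler_sum => x _; apply: ler_sum => y _; rewrite lerD2r.
by rewrite /dens /cexp lexx.
Qed.

Lemma exists_cut_regular (R : archiRealFieldType) (Sigma : finType) (eta : R) :
  0 < eta -> forall K : finType, exists K' : finType,
  forall (V : finType) (g : V -> V -> Sigma) (c : V -> K),
    exists c' : V -> K', refines c' c /\ cut_regular g c' eta.
Proof.
(* This [d] makes the energy threshold nonpositive, so every starting colouring meets it. *)
move=> e0 K; pose d := Num.bound (#|Sigma|.+1%:R / eta ^+ 2).
have [K' HK'] := cut_regular_aux Sigma d e0 K; exists K' => V g c; apply: HK'.
apply: (@le_trans _ _ 0); last first.
  apply: sumr_ge0 => s _; rewrite divr_ge0 ?ler0n ?sumr_ge0 // => x _.
  exact: sqr_ge0.
rewrite subr_le0 -ler_pdivrMr ?exprn_gt0 //; apply/ltW/archi_boundP.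
by rewrite divr_ge0 ?ler0n ?sqr_ge0.
Qed.

Section CutFunctional.
Context {R : realFieldType} {V : finType}.
Variables (D : V * V -> R) (b : R).
Hypothesis cutD : forall A B : {set V}, \sum_(x in A) \sum_(y in B) D (x, y) <= b.

(** A bilinear form on weights between 0 and 1 is largest at indicators: replace [f], then [h], by
    the set where its coefficient is nonnegative. *)
Lemma cut_functional (f h : V -> R) :
  (forall x, 0 <= f x <= 1) -> (forall x, 0 <= h x <= 1) ->
  \sum_x \sum_y D (x, y) * f x * h y <= b.
Proof.
have pos (F f' : V -> R) : (forall x, 0 <= f' x <= 1) ->
    \sum_x f' x * F x <= \sum_(x in [set x | 0 <= F x]) F x.
  move=> f01; rewrite [leRHS]big_mkcond /=; apply: ler_sum => x _; rewrite inE.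
  case/andP: (f01 x) => f0 f1; case: (leP 0 (F x)) => F0; first by rewrite ler_piMl.
  by rewrite mulr_ge0_le0 // ltW.
move=> f01 h01.
pose F x := \sum_y D (x, y) * h y.
pose A := [set x | 0 <= F x].
pose G y := \sum_(x in A) D (x, y).
apply: le_trans (cutD A [set y | 0 <= G y]).
rewrite [leRHS]exchange_big /=.
apply: le_trans (pos G h h01).
have -> : \sum_y h y * G y = \sum_(x in A) F x.
  rewrite /F exchange_big /=; apply: eq_bigr => y _.
  by rewrite mulr_sumr; apply: eq_bigr => x _; rewrite mulrC.
apply: le_trans (pos F f f01); apply: ler_sum => x _.
by rewrite mulr_sumr; apply: ler_sum => y _; rewrite mulrAC mulrC mulrA.
Qed.

End CutFunctional.

(** * Counting lemma with vertex weights *)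

Section Counting.
Context {R : realFieldType} {V : finType} {q : nat}.
Implicit Types (x : {ffun 'I_q -> V}).

Definition upd x (a : 'I_q) (y : V) : {ffun 'I_q -> V} :=
  [ffun i => if i == a then y else x i].

(** Exchanging the new value of coordinate [a] with the old one is an involution on pairs of a tuple
    and a value. *)
Lemma sum_upd (a : 'I_q) (phi : {ffun 'I_q -> V} -> R) :
  \sum_x \sum_y phi (upd x a y) = #|V|%:R * \sum_x phi x.
Proof.
rewrite pair_bigA /=; pose sw (p : {ffun 'I_q -> V} * V) := (upd p.1 a p.2, p.1 a).
have swK : involutive sw.
  move=> [x y]; rewrite /sw /= ffunE eqxx; congr (_, _).
  by apply/ffunP => i; rewrite !ffunE; case: eqP => // ->.
rewrite (reindex_inj (inv_inj swK)) /=.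
transitivity (\sum_(p : {ffun 'I_q -> V} * V) phi p.1).
  apply: eq_bigr => -[x y] _ /=; congr phi; apply/ffunP => i.
  by rewrite !ffunE; case: eqP => // ->.
rewrite -(pair_bigA _ (fun x (_ : V) => phi x)) /= mulr_sumr.
by apply: eq_bigr => x _; rewrite sumr_const mulr_natl.
Qed.

Definition indep (a : 'I_q) (phi : {ffun 'I_q -> V} -> R) :=
  forall x y, phi (upd x a y) = phi x.

Lemma updC x a b y z : a != b -> upd (upd x a y) b z = upd (upd x b z) a y.
Proof.
move=> ab; apply/ffunP => i; rewrite !ffunE.
by case: eqP => // ->; rewrite eq_sym (negbTE ab).
Qed.

(** Once all coordinates except [a] and [b] are frozen, [Phi] depends on the first alone and [Psi]
    on the second alone, so [cut_functional] applies. *)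
Lemma cut_swap (D : V * V -> R) (e : R) (a b : 'I_q) (Phi Psi : {ffun 'I_q -> V} -> R) :
  (forall A B : {set V}, \sum_(x in A) \sum_(y in B) D (x, y) <= e * #|V|%:R ^+ 2) ->
  a != b -> (forall x, 0 <= Phi x <= 1) -> (forall x, 0 <= Psi x <= 1) ->
  indep b Phi -> indep a Psi ->
  \sum_(x : {ffun 'I_q -> V}) D (x a, x b) * (Phi x * Psi x) <= e * #|V|%:R ^+ q.
Proof.
move=> cutD ab Phi01 Psi01 iPhi iPsi.
have [V0|V0] := posnP #|V|.
  rewrite V0 expr0n; case: (posnP q) => [q0|q0].
    by exfalso; have := ltn_ord a; rewrite [X in (_ < X)%N]q0.
  rewrite mulr0 big1 // => x _.
  by have := card0_eq V0 (x a); rewrite inE.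
rewrite -(ler_pM2l (x := #|V|%:R ^+ 2)) ?exprn_gt0 ?ltr0n //.
pose phi (x : {ffun 'I_q -> V}) := D (x a, x b) * (Phi x * Psi x).
have -> : #|V|%:R ^+ 2 * \sum_x phi x =
          \sum_x \sum_y \sum_z phi (upd (upd x a y) b z).
  by rewrite (sum_upd a (fun x => \sum_z phi (upd x b z))) sum_upd mulrA.
have -> : #|V|%:R ^+ 2 * (e * #|V|%:R ^+ q) =
          \sum_(x : {ffun 'I_q -> V}) e * #|V|%:R ^+ 2.
  by rewrite sumr_const card_ffun card_ord -[RHS]mulr_natr natrX; ring.
apply: ler_sum => x _.
apply: le_trans (cut_functional cutD (f := fun y => Phi (upd x a y))
  (h := fun z => Psi (upd x b z)) _ _) => //.
apply: ler_sum => y _; apply: ler_sum => z _.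
have -> : phi (upd (upd x a y) b z) =
          D (y, z) * (Phi (upd x a y) * Psi (upd x b z)).
  rewrite /phi iPhi [in Psi _]updC // iPsi; congr (D (_, _) * _).
    by rewrite !ffunE (negbTE ab) eqxx.
  by rewrite ffunE eqxx.
by rewrite mulrA.
Qed.

Variables (Sigma : finType) (g : V -> V -> Sigma) (K : finType) (c : V -> K) (e : R).
Hypothesis reg : cut_regular g c e.
Hypothesis e0 : 0 <= e.
Variables (F : 'I_q -> 'I_q -> Sigma) (w : 'I_q -> V -> R).
Hypothesis w01 : forall a v, 0 <= w a v <= 1.

Let pairs := [pred p : 'I_q * 'I_q | (p.1 < p.2)%N].
(** Hybrid factors: the pairs listed in [A] already carry the true colour indicator, the others
    still carry the density. *)
Let fac (A : seq ('I_q * 'I_q)) x (p : 'I_q * 'I_q) : R :=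
  if p \in A then has_col g (F p.1 p.2) (x p.1, x p.2)
  else dens g c (F p.1 p.2) (x p.1, x p.2).
Let hyb A := \sum_(x : {ffun 'I_q -> V}) \prod_a w a (x a) * \prod_(p | pairs p) fac A x p.

Let fac01 A x p : 0 <= fac A x p <= 1.
Proof.
rewrite /fac; case: ifP => _; first exact: has_col01.
by rewrite (dens_ge0 g c) (dens_le1 g c).
Qed.

Lemma prod01 (I : finType) (P : pred I) (f : I -> R) :
  (forall i, 0 <= f i <= 1) -> 0 <= \prod_(i | P i) f i <= 1.
Proof.
move=> f01; elim/big_ind: _ => [|x y /andP[x0 x1] /andP[y0 y1]|//].
  by rewrite ler01 lexx.
by rewrite mulr_ge0 // mulr_ile1.
Qed.

Let mul01 (x y : R) : 0 <= x <= 1 -> 0 <= y <= 1 -> 0 <= x * y <= 1.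
Proof. by move=> /andP[x0 x1] /andP[y0 y1]; rewrite mulr_ge0 // mulr_ile1. Qed.

Let hyb_step A p : hyb A <= hyb (p :: A) + e * #|V|%:R ^+ q.
Proof.
have [pA|pA] := boolP (p \in A).
  have -> : hyb (p :: A) = hyb A.
    apply: eq_bigr => x _; congr (_ * _); apply: eq_bigr => p' _.
    by rewrite /fac inE; case: eqP => // ->; rewrite pA.
  by rewrite lerDl mulr_ge0 ?exprn_ge0 ?ler0n.
have [pp|pp] := boolP (pairs p); last first.
  have -> : hyb (p :: A) = hyb A.
    apply: eq_bigr => x _; congr (_ * _); apply: eq_bigr => p' pp'.
    by rewrite /fac inE; case: eqP => // E; rewrite E (negbTE pp) in pp'.
  by rewrite lerDl mulr_ge0 ?exprn_ge0 ?ler0n.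
have ab : p.1 != p.2 by move: pp; rewrite /= -val_eqE /= neq_ltn => ->.
(* Sort the remaining factors by whether they involve [p.2]. Those that do cannot involve [p.1],
   because [p] is the only increasing pair with these two ends. *)
pose inv (p' : 'I_q * 'I_q) := (p'.1 == p.2) || (p'.2 == p.2).
pose Phi (x : {ffun 'I_q -> V}) := \prod_(a | a != p.2) w a (x a) *
   \prod_(p' | (pairs p' && (p' != p)) && ~~ inv p') fac A x p'.
pose Psi (x : {ffun 'I_q -> V}) := w p.2 (x p.2) *
   \prod_(p' | (pairs p' && (p' != p)) && inv p') fac A x p'.
have H := @cut_swap (fun y => dens g c (F p.1 p.2) y - has_col g (F p.1 p.2) y)
   e p.1 p.2 Phi Psi (reg (F p.1 p.2)) ab.
rewrite -lerBlDl; apply: le_trans (H _ _ _ _).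
- rewrite /hyb -sumrB le_eqVlt; apply/orP; left; apply/eqP.
  apply: eq_bigr => x _.
  rewrite (bigD1 (P := pairs) p) //= [in X in _ - X](bigD1 (P := pairs) p) //=.
  rewrite (bigD1 p.2) //= {1 3}/fac (negbTE pA) mem_head.
  have -> : \prod_(i | pairs i && (i != p)) fac (p :: A) x i =
            \prod_(i | pairs i && (i != p)) fac A x i.
    by apply: eq_bigr => p' /andP[_ np]; rewrite /fac inE (negbTE np).
  rewrite (bigID inv (fun i => pairs i && (i != p))) /= /Phi /Psi; ring.
- move=> x; apply: mul01; apply: prod01 => i; [exact: w01 | exact: fac01].
- move=> x; apply: mul01; first exact: w01.
  by apply: prod01 => i; exact: fac01.
- move=> x y; congr (_ * _).
    by apply: eq_bigr => i ni; rewrite ffunE (negbTE ni).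
  apply: eq_bigr => p' /andP[_]; rewrite negb_or => /andP[n1 n2].
  by rewrite /fac !ffunE (negbTE n1) (negbTE n2).
- move=> x y; congr (_ * _); first by rewrite ffunE eq_sym (negbTE ab).
  apply: eq_bigr => p' /andP[/andP[pp' np]]; rewrite /inv => ip.
  have [n1 n2] : p'.1 != p.1 /\ p'.2 != p.1.
    move: pp pp' np ip; rewrite /= -pair_eqE /pair_eq -!val_eqE /=; lia.
  by rewrite /fac !ffunE (negbTE n1) (negbTE n2).
Qed.

(** Exchange densities for indicators one pair at a time, by [hyb_step]. Running through all [q ^ 2]
    ordered pairs overcounts the steps harmlessly. *)
Lemma counting :
  \sum_(x : {ffun 'I_q -> V}) \prod_a w a (x a) *
     \prod_(p : 'I_q * 'I_q | (p.1 < p.2)%N) dens g c (F p.1 p.2) (x p.1, x p.2) <=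
  \sum_(x : {ffun 'I_q -> V}) \prod_a w a (x a) *
     \prod_(p : 'I_q * 'I_q | (p.1 < p.2)%N) has_col g (F p.1 p.2) (x p.1, x p.2)
  + (q ^ 2)%:R * e * #|V|%:R ^+ q.
Proof.
have H A : hyb [::] <= hyb A + (size A)%:R * (e * #|V|%:R ^+ q).
  elim: A => [|p A IH]; first by rewrite mul0r addr0.
  by apply: le_trans IH _; have := hyb_step A p; rewrite /= -natr1; lra.
have := H (enum {: 'I_q * 'I_q}); rewrite -mulrA.
have -> : size (enum {: 'I_q * 'I_q}) = (q ^ 2)%N.
  by rewrite -cardE card_prod card_ord mulnn.
set y := (X in _ <= X + _); set z := (X in _ -> _ <= X + _).
suff <- : y = z by apply: le_trans; rewrite le_eqVlt; apply/orP; left; apply/eqP;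
  apply: eq_bigr => x _; congr (_ * _); apply: eq_bigr => p _; rewrite /fac in_nil.
apply: eq_bigr => x _; congr (_ * _); apply: eq_bigr => p _.
by rewrite /fac mem_enum.
Qed.

End Counting.

(** * Ordered graphs and induced copies *)

Section OrderedGraphs.
Context {Sigma : finType}.
Variable (s0 : Sigma).

(** The densities need a colour for every ordered pair of vertices. This function is symmetric, and
    [s0] is its value on the diagonal only. *)
Definition ecol (n : nat) (G : ordgraph Sigma n) (x y : 'I_n) : Sigma :=
  if insub [set x; y] is Some e then G e else s0.

Lemma ecolE n (G : ordgraph Sigma n) (e : vpair n) x y :
  val e = [set x; y] -> ecol G x y = G e.
Proof. by move=> ve; rewrite /ecol -ve valK. Qed.

Lemma vpair_ex n (x y : 'I_n) : (x < y)%N -> {e : vpair n | val e = [set x; y]}.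
Proof.
move=> xy; have c2 : #|[set x; y]| == 2.
  by rewrite cards2 -val_eqE /= (ltn_eqF xy).
by exists (Sub [set x; y] c2); rewrite SubK.
Qed.

Lemma vpairP n (e : vpair n) : exists p : 'I_n * 'I_n, (p.1 < p.2)%N && (val e == [set p.1; p.2]).
Proof.
case: e => e /= /cards2P[x [y [xy ->]]].
have [lt|le] := ltnP x y; first by exists (x, y); rewrite lt /=.
exists (y, x); rewrite /= ltn_neqAle le eq_sym xy /=; apply/eqP.
by apply/setP => z; rewrite !inE orbC.
Qed.

Definition vends n (e : vpair n) : 'I_n * 'I_n := xchoose (vpairP e).

Lemma vendsP n (e : vpair n) :
  ((vends e).1 < (vends e).2)%N /\ val e = [set (vends e).1; (vends e).2].
Proof. by have /andP[? /eqP] := xchooseP (vpairP e). Qed.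

Lemma vends_inj n : injective (@vends n).
Proof.
move=> e f ef; apply: val_inj.
by rewrite (proj2 (vendsP e)) ef -(proj2 (vendsP f)).
Qed.

Lemma set2_lt_inj n (x y z t : 'I_n) : (x < y)%N -> (z < t)%N ->
  [set x; y] = [set z; t] -> x = z /\ y = t.
Proof.
move=> xy zt E.
have : x \in [set z; t] by rewrite -E set21.
have : y \in [set z; t] by rewrite -E set22.
rewrite !inE => /orP[]/eqP ey /orP[]/eqP ex; subst; move: xy zt; try lia.
by [].
Qed.

Definition mkgraph n (f : 'I_n -> 'I_n -> Sigma) : ordgraph Sigma n :=
  [ffun e => f (vends e).1 (vends e).2].

Lemma ecol_mkgraph n (f : 'I_n -> 'I_n -> Sigma) (x y : 'I_n) :
  (x < y)%N -> ecol (mkgraph f) x y = f x y.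
Proof.
move=> xy; have [e ve] := vpair_ex xy; rewrite (ecolE _ ve) ffunE.
have [lt ve'] := vendsP e; rewrite ve' in ve.
by have [-> ->] := set2_lt_inj lt xy ve.
Qed.

Lemma ecol_osubgraph n (G : ordgraph Sigma n) (U : {set 'I_n}) (a b : 'I_#|U|) :
  (a < b)%N -> ecol (osubgraph G U) a b = ecol G (enum_val a) (enum_val b).
Proof.
move=> ab; have [e ve] := vpair_ex ab; rewrite (ecolE _ ve) ffunE.
by rewrite (@ecolE _ _ (vpair_imset e)) //= ve imsetU1 imset_set1.
Qed.

(** Eliminating [E] leaves an ordinary equality of functions on pairs, so no transport along
    [#|U| = q] is ever computed. *)
Lemma ordgraph_tagged n1 n2 (E : n1 = n2) (F1 : ordgraph Sigma n1) (F2 : ordgraph Sigma n2) :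
  (forall a b : 'I_n1, (a < b)%N -> ecol F1 a b = ecol F2 (cast_ord E a) (cast_ord E b)) ->
  Tagged (ordgraph Sigma) F1 = Tagged (ordgraph Sigma) F2.
Proof.
case: _ / E F2 => F2 H; congr (Tagged _ _); apply/ffunP => e.
have [lt ve] := vendsP e.
by rewrite -(ecolE F1 ve) -(ecolE F2 ve) H // !cast_ord_id.
Qed.

Lemma enum_set_sorted n (U : {set 'I_n}) :
  sorted (fun x y : 'I_n => (x < y)%N) (enum U).
Proof.
rewrite /enum_mem; apply: sorted_filter; first by move=> x y z; apply: ltn_trans.
rewrite -enumT; have := iota_ltn_sorted 0 n; rewrite -val_enum_ord.
by rewrite sorted_map.
Qed.

(** Two strictly increasing lists with the same members coincide. *)
Lemma enum_increasing n q (f : 'I_q -> 'I_n) :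
  (forall a b : 'I_q, (a < b)%N -> (f a < f b)%N) ->
  enum [set f a | a : 'I_q] = map f (enum 'I_q).
Proof.
move=> incr; apply: (@irr_sorted_eq _ (fun x y : 'I_n => (x < y)%N)).
- by move=> x y z; apply: ltn_trans.
- by move=> x; rewrite /= ltnn.
- exact: enum_set_sorted.
- rewrite sorted_map; apply: (@sub_sorted _ (fun x y : 'I_q => (x < y)%N)) => //.
  have := iota_ltn_sorted 0 q; rewrite -val_enum_ord.
  by rewrite sorted_map.
- move=> x; rewrite mem_enum; apply/imsetP/mapP => -[a _ ->]; exists a => //.
  by rewrite mem_enum.
Qed.

Lemma increasing_eq n q (f g : 'I_q -> 'I_n) :
  (forall a b : 'I_q, (a < b)%N -> (f a < f b)%N) ->
  (forall a b : 'I_q, (a < b)%N -> (g a < g b)%N) ->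
  [set f a | a : 'I_q] = [set g a | a : 'I_q] -> f =1 g.
Proof.
move=> incf incg E a.
have := enum_increasing incf; rewrite E enum_increasing // => /esym/eq_in_map.
by apply; rewrite mem_enum.
Qed.

(** The sorted enumeration of the image is [f] itself, so ranks in the image are arguments of
    [f]. *)
Lemma increasing_copy n q (G : ordgraph Sigma n) (F : ordgraph Sigma q) (f : 'I_q -> 'I_n) :
  (forall a b : 'I_q, (a < b)%N -> (f a < f b)%N) ->
  (forall a b : 'I_q, (a < b)%N -> ecol G (f a) (f b) = ecol F a b) ->
  [set f a | a : 'I_q] \in induced_copies F G.
Proof.
move=> incr col; set U := [set _ | _ in _].
have finj : injective f.
  move=> a b; case: (ltngtP a b) => [/incr|/incr|/val_inj //] lt E;
    by rewrite E ltnn in lt.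
have E : #|U| = q by rewrite card_imset // card_ord.
rewrite inE; apply/eqP; apply: (ordgraph_tagged (E := E)) => a b ab.
have ev (i : 'I_#|U|) : enum_val i = f (cast_ord E i).
  rewrite /enum_val enum_increasing // (nth_map (cast_ord E i)); last first.
    by rewrite size_enum_ord -[X in (_ < X)%N]E.
  by congr f; apply: val_inj; rewrite /= nth_enum_ord // -[X in (_ < X)%N]E.
by rewrite ecol_osubgraph // !ev col.
Qed.

(** Separated supports make every contributing tuple increasing. Such a tuple is determined by its
    image, so contributing tuples inject into copies. *)
Lemma weighted_copies_le (R : realFieldType) n q (G : ordgraph Sigma n)
    (F : ordgraph Sigma q) (S : 'I_q -> {set 'I_n}) :
  (forall (a b : 'I_q) x y, (a < b)%N -> x \in S a -> y \in S b -> (x < y)%N) ->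
  \sum_(x : {ffun 'I_q -> 'I_n}) \prod_a (x a \in S a)%:R *
    \prod_(p : 'I_q * 'I_q | (p.1 < p.2)%N)
       has_col (ecol G) (ecol F p.1 p.2) (x p.1, x p.2)
  <= #|induced_copies F G|%:R :> R.
Proof.
move=> sep.
pose A := [set x : {ffun 'I_q -> 'I_n} | [forall a, x a \in S a] &&
  [forall p : 'I_q * 'I_q, (p.1 < p.2)%N ==> (ecol G (x p.1) (x p.2) == ecol F p.1 p.2)]].
apply: (@le_trans _ _ (\sum_(x in A) 1)); last first.
  rewrite sumr_const ler_nat.
  have incA x : x \in A -> forall a b : 'I_q, (a < b)%N -> (x a < x b)%N.
    by rewrite inE => /andP[/forallP xS _] a b ab; apply: sep ab _ _.
  rewrite -(card_in_imset (f := fun x : {ffun 'I_q -> 'I_n} => [set x a | a : 'I_q])).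
    apply/subset_leq_card/subsetP => _ /imsetP[x xA ->].
    apply: increasing_copy (incA x xA) _ => a b ab.
    by move: xA; rewrite inE => /andP[_ /forallP/(_ (a, b))]; rewrite ab => /eqP.
  move=> x y xA yA E; apply/ffunP.
  exact: increasing_eq (incA x xA) (incA y yA) E.
rewrite [leRHS]big_mkcond /=; apply: ler_sum => x _.
have b01 (b : bool) : (0 : R) <= (b%:R : R) <= 1 by rewrite ler0n lern1 leq_b1.
rewrite inE; have [xS|] := boolP [forall a, x a \in S a]; last first.
  by rewrite negb_forall => /existsP[a /negbTE xa]; rewrite (bigD1 a) //= xa !mul0r.
case: ifPn => [_|]; last first.
  rewrite negb_forall => /existsP[p]; rewrite negb_imply => /andP[pp /negbTE ne].
  by rewrite mulrC (bigD1 p) //= /has_col ne !mul0r.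
have /andP[a0 a1] := prod01 xpredT (f := fun a => (x a \in S a)%:R) (fun a => b01 _).
have /andP[c0 c1] := prod01 (fun p : 'I_q * 'I_q => (p.1 < p.2)%N)
  (f := fun p => has_col (ecol G) (ecol F p.1 p.2) (x p.1, x p.2)) (fun a => b01 _).
exact: mulr_ile1.
Qed.

End OrderedGraphs.

(** * Product weights and interval partitions *)

Section Products.
Context {R : realFieldType}.

(** Expand [f] over the possible restrictions [z]; the sum over [x] then factors over coordinates,
    and those outside the image of [e] contribute 1. *)
Lemma sum_ffun_marginal (I J B : finType) (p : I -> B -> R) (e : J -> I)
    (f : {ffun J -> B} -> R) :
  injective e -> (forall i, \sum_b p i b = 1) ->
  \sum_(x : {ffun I -> B}) \prod_i p i (x i) * f [ffun j => x (e j)] =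
  \sum_(z : {ffun J -> B}) \prod_j p (e j) (z j) * f z.
Proof.
move=> einj p1.
transitivity (\sum_(x : {ffun I -> B}) \sum_(z : {ffun J -> B})
   f z * (\prod_i p i (x i) * \prod_j (x (e j) == z j)%:R)).
  apply: eq_bigr => x _; rewrite (bigD1 [ffun j => x (e j)]) //=.
  rewrite [X in _ = _ + X]big1 => [|z nz].
    by rewrite addr0 [X in _ * (_ * X)]big1 ?mulr1 1?mulrC // => j _; rewrite ffunE eqxx.
  suff [j /negbTE ne] : exists j, x (e j) != z j by rewrite (bigD1 j) //= ne mul0r !mulr0.
  apply/existsP; rewrite -negb_forall; apply: contra nz => /forallP H.
  by apply/eqP/ffunP => j; rewrite ffunE (eqP (H j)).
rewrite exchange_big /=; apply: eq_bigr => z _; rewrite -mulr_sumr mulrC.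
congr (_ * _).
transitivity (\sum_(x : {ffun I -> B}) \prod_i
    (p i (x i) * \prod_(j | e j == i) (x i == z j)%:R)).
  apply: eq_bigr => x _; rewrite big_split /=; congr (_ * _).
  rewrite (partition_big e xpredT) //=; apply: eq_bigr => i _.
  by apply: eq_bigr => j /eqP->.
rewrite -(bigA_distr_bigA (fun i b => p i b * \prod_(j | e j == i) (b == z j)%:R)) /=.
rewrite [RHS](partition_big e xpredT) //=; apply: eq_bigr => i _.
have [/existsP[j0 /eqP<-]|ni] := boolP [exists j, e j == i].
  have E j : (e j == e j0) = (j == j0) by apply/eqP/eqP => [/einj|->].
  rewrite [RHS](eq_bigl _ _ E) big_pred1_eq (bigD1 (z j0)) //= (eq_bigl _ _ E).
  rewrite big_pred1_eq eqxx mulr1 big1 ?addr0 // => b /negbTE nb.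
  by rewrite (eq_bigl _ _ E) big_pred1_eq nb mulr0.
have E j : (e j == i) = false.
  by apply: contraNF ni => H; apply/existsP; exists j.
rewrite [RHS]big_pred0 // -[RHS](p1 i); apply: eq_bigr => b _.
by rewrite big_pred0 ?mulr1.
Qed.

Lemma sum_ffun_pair (I B : finType) (p : I -> B -> R) (a b : I) (f : B -> B -> R) :
  a != b -> (forall i, \sum_y p i y = 1) ->
  \sum_(x : {ffun I -> B}) \prod_i p i (x i) * f (x a) (x b) =
  \sum_y \sum_z p a y * p b z * f y z.
Proof.
move=> ab p1; pose e (j : bool) := if j then a else b.
have einj : injective e.
  by case=> -[] // E; move: ab; rewrite /e in E; rewrite E eqxx.
have := sum_ffun_marginal (fun z : {ffun bool -> B} => f (z true) (z false)) einj p1.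
rewrite (eq_bigr (fun x : {ffun I -> B} => \prod_i p i (x i) * f (x a) (x b))) => [->|x _];
  last by rewrite !ffunE.
rewrite (reindex (fun q : B * B => [ffun j : bool => if j then q.1 else q.2])) /=.
  rewrite pair_bigA /=; apply: eq_bigr => q _.
  by rewrite big_bool /= !ffunE.
exists (fun z : {ffun bool -> B} => (z true, z false)) => [[y z] _|z _].
  by rewrite !ffunE.
by apply/ffunP => -[]; rewrite ffunE.
Qed.

Lemma sum_ffun_one (I B : finType) (p : I -> B -> R) :
  (forall i, \sum_y p i y = 1) ->
  \sum_(x : {ffun I -> B}) \prod_i p i (x i) = 1.
Proof.
move=> p1; rewrite -(bigA_distr_bigA p) /=.
by rewrite big1.
Qed.

End Products.

(** * Partitions of the vertex order into nearly equal intervals *)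

Section Positions.

(** Scaling before dividing makes these partitions nest without rounding error when the number of
    intervals is multiplied, see [pos_div]. *)
Definition pos (m n : nat) (v : 'I_n) : 'I_m.+1 := inord (v * m.+1 %/ n).

Lemma posE m n (v : 'I_n) : pos m v = (v * m.+1 %/ n)%N :> nat.
Proof.
rewrite inordK // ltn_divLR ?(leq_ltn_trans _ (ltn_ord v)) //.
by rewrite mulnC ltn_pmul2l.
Qed.

Lemma pos_mono m n (v w : 'I_n) : (v <= w)%N -> (pos m v <= pos m w)%N.
Proof. by move=> vw; rewrite !posE leq_div2r // leq_mul2r vw orbT. Qed.

Lemma pos_div m d m2 n (v : 'I_n) : (0 < d)%N -> m2.+1 = (m.+1 * d)%N ->
  (pos m2 v %/ d)%N = pos m v.
Proof.
move=> d0 E; rewrite !posE E mulnA -divnMA -[in RHS](@divnMr d) //.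
Qed.

Lemma pos_refines m d m2 n : (0 < d)%N -> m2.+1 = (m.+1 * d)%N ->
  refines (@pos m2 n) (@pos m n).
Proof.
by move=> d0 E x y H; apply: val_inj; rewrite /= -!(pos_div _ d0 E) H.
Qed.

Lemma posP m n (v : 'I_n) (a : 'I_m.+1) :
  (pos m v == a) = (a * n <= v * m.+1 < a.+1 * n)%N.
Proof.
have n0 : (0 < n)%N by apply: leq_ltn_trans (ltn_ord v).
by rewrite -val_eqE /= posE -leq_divRL // -ltn_divLR // ltnS -eqn_leq eq_sym.
Qed.

Lemma pos_fiber_le m n (a : 'I_m.+1) :
  (#|[pred v : 'I_n | pos m v == a]| * m.+1 <= n + m.+1)%N.
Proof.
pose A := [set v : 'I_n | pos m v == a].
have -> : #|[pred v : 'I_n | pos m v == a]| = #|A|.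
  by apply: eq_card => v; rewrite !inE.
have [->|[v0 _]] := set_0Vmem A; first by rewrite cards0.
have n0 : (0 < n + m.+1)%N by rewrite addnS.
(* The number [v * m.+1 + r - a * n] determines [v] and [r] and lies below [n + m.+1] on the fibre;
   the modulus only serves to make [f] total. *)
pose f (p : 'I_n * 'I_m.+1) : 'I_(n + m.+1) :=
  Ordinal (ltn_pmod (p.1 * m.+1 + p.2 - a * n) n0).
rewrite -[X in (_ * X <= _)%N]card_ord -cardsT -cardsX.
rewrite -[X in (_ <= X)%N]card_ord -(card_in_imset (f := f)).
  exact: max_card.
move=> [v r] [w s]; rewrite !inE !andbT !posP (mulSn a) /= => /andP[v1 v2] /andP[w1 w2].
have [hr hs] := (ltn_ord r, ltn_ord s).
move=> /(congr1 val) /=; rewrite !modn_small; [|by lia..] => E.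
have {}E : (v * m.+1 + r = w * m.+1 + s)%N by lia.
have vw : v = w :> nat.
  by have := congr1 (divn^~ m.+1) E; rewrite !divnMDl // !divn_small // !addn0.
congr (_, _); apply: val_inj => //=; move: E; rewrite vw; lia.
Qed.

Lemma pos_fiber_ge m n (a : 'I_m.+1) :
  (n <= #|[pred v : 'I_n | pos m v == a]| * m.+1 + m.+1)%N.
Proof.
case: n => [//|n]; pose A := [set v : 'I_n.+1 | pos m v == a].
have -> : #|[pred v : 'I_n.+1 | pos m v == a]| = #|A|.
  by apply: eq_card => v; rewrite !inE.
have [le|lt] := leqP n.+1 m.+1; first by apply: leq_trans le _; rewrite leq_addl.
(* Conversely, divide by [m.+1]. The added [m.+1] keeps the quotient from falling below the interval
   when the remainder is dropped. *)
pose f (y : 'I_(n.+1 - m.+1)) : 'I_n.+1 * 'I_m.+1 :=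
  (inord ((y + a * n.+1 + m.+1) %/ m.+1), inord ((y + a * n.+1 + m.+1) %% m.+1)).
have fE (y : 'I_(n.+1 - m.+1)) : let v := (f y).1 in let r := (f y).2 in
   (v * m.+1 + r = y + a * n.+1 + m.+1)%N.
  rewrite /f /= !inordK ?ltn_mod //; first by rewrite -divn_eq.
  rewrite ltn_divLR // (mulnC n.+1) mulSn.
  have : (a * n.+1 <= m * n.+1)%N by rewrite leq_mul2r -ltnS ltn_ord orbT.
  by have := ltn_ord y; lia.
rewrite addnC -leq_subLR -[X in (_ <= _ * X)%N]card_ord.
rewrite -[X in (_ * X)%N]cardsT -cardsX -[X in (X <= _)%N]card_ord.
have finj : injective f.
  move=> y z E; apply: val_inj => /=; have Hy := fE y; have Hz := fE z; rewrite E in Hy; lia.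
rewrite -cardsT -(card_imset _ finj); apply/subset_leq_card/subsetP => _ /imsetP[y _ ->].
rewrite !inE andbT posP. have := fE y; have := ltn_ord y; have := ltn_ord (f y).2; move: (f y) => [/= v r].
by rewrite mulSn; lia.
Qed.

End Positions.

(** * Slots and sampling supports *)

Section Averages.
Context {R : realFieldType} {V : finType}.
Implicit Types (A : {set V}) (f : V -> R).

Definition avg A f : R := (\sum_(x in A) f x) / #|A|%:R.

Lemma avg_ge0 A f : (forall x, 0 <= f x) -> 0 <= avg A f.
Proof. by move=> f0; rewrite divr_ge0 ?ler0n ?sumr_ge0. Qed.

Lemma avg_le A f h : (forall x, f x <= h x) -> avg A f <= avg A h.
Proof. by move=> fh; rewrite ler_wpM2r ?invr_ge0 ?ler0n // ler_sum. Qed.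

Lemma avg_cst_le A (r : R) : 0 <= r -> avg A (fun=> r) <= r.
Proof.
move=> r0; rewrite /avg sumr_const -[r *+ _]mulr_natr; case: (posnP #|A|) => [->|A0].
  by rewrite mulr0 mul0r.
by rewrite mulfK // pnatr_eq0 -lt0n.
Qed.

Lemma avgD A f h : avg A (fun x => f x + h x) = avg A f + avg A h.
Proof. by rewrite /avg big_split /= mulrDl. Qed.

Lemma avgZ A f r : avg A (fun x => r * f x) = r * avg A f.
Proof. by rewrite /avg -mulr_sumr mulrA. Qed.

Lemma avg_sum (I : finType) (P : pred I) A (f : I -> V -> R) :
  avg A (fun x => \sum_(i | P i) f i x) = \sum_(i | P i) avg A (f i).
Proof. by rewrite /avg exchange_big /= mulr_suml. Qed.

Lemma sum_avg A f (k : V -> R) :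
  (forall x, k x = (x \in A)%:R / #|A|%:R) -> \sum_x k x * f x = avg A f.
Proof.
move=> kE; rewrite /avg mulr_suml [RHS]big_mkcond /=; apply: eq_bigr => x _.
by rewrite kE; case: (x \in A); rewrite ?mul0r // mul1r mulrC.
Qed.

End Averages.

Section Slots.
Context {R : realFieldType} {K : finType}.
Variables (m M m2 N : nat) (c : 'I_N -> K) (xi : R).
Hypothesis M0 : (0 < M)%N.
Hypothesis m2E : m2.+1 = (m.+1 * (2 * M))%N.
Hypothesis Nbig : (4 * m2.+1 <= N)%N.
Hypothesis xi0 : 0 < xi.
Hypothesis xi1 : xi <= 1.

Let U0 : (0 < 2 * M)%N. Proof. by rewrite muln_gt0. Qed.

Definition slot_interval (t : 'I_m2.+1) : 'I_m.+1 := inord (t %/ (2 * M)).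

Lemma slot_intervalE (t : 'I_m2.+1) : slot_interval t = (t %/ (2 * M))%N :> nat.
Proof. by rewrite inordK // ltn_divLR // -m2E. Qed.

Lemma slot_interval_pos (v : 'I_N) : slot_interval (pos m2 v) = pos m v.
Proof. by apply: val_inj; rewrite /= slot_intervalE (pos_div _ U0 m2E). Qed.

Definition cell (v : 'I_N) : K * 'I_m.+1 := (c v, pos m v).
Definition cells (q : K * 'I_m.+1) : {set 'I_N} := [set v | cell v == q].
Definition slots (t : 'I_m2.+1) : {set 'I_N} := [set v | pos m2 v == t].
Definition intvl (a : 'I_m.+1) : {set 'I_N} := [set v | pos m v == a].
Definition cellslot (b : K) (t : 'I_m2.+1) : {set 'I_N} :=
  [set v | (c v == b) && (pos m2 v == t)].

Definition ratio (A B : {set 'I_N}) : R := #|A|%:R / #|B|%:R.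

(* The additive [xi] ensures that [cellslot b t] is large enough to be sampled
   from with bounded density. *)
Definition good (b : K) (t : 'I_m2.+1) : bool :=
  ratio (cells (b, slot_interval t)) (intvl (slot_interval t)) + xi
  <= 2 * ratio (cellslot b t) (slots t).

(** Falling back on the whole slot keeps the support nonempty and inside the slot, hence the sampled
    map increasing. The wrong colour is charged to [Bad]. *)
Definition supp (b : K) (t : 'I_m2.+1) : {set 'I_N} :=
  if good b t then cellslot b t else slots t.

Lemma supp_sub b t : supp b t \subset slots t.
Proof.
rewrite /supp; case: ifP => // _; apply/subsetP => v.
by rewrite !inE => /andP[].
Qed.

Lemma slots_card t : (3 * N <= 4 * (#|slots t| * m2.+1))%N.
Proof.
have := pos_fiber_ge N t.
rewrite (eq_card (A := [pred v : 'I_N | pos m2 v == t]) (B := slots t)) => [|v]; last by rewrite !inE.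
move: Nbig; move: (#|slots t| * _)%N => x; move: (m2.+1) => y; clear; lia.
Qed.

Lemma intvl_card a t : (#|intvl a| <= 2 * (2 * M) * #|slots t|)%N.
Proof.
have := pos_fiber_le N a.
rewrite (eq_card (A := [pred v : 'I_N | pos m v == a]) (B := intvl a)) => [|v]; last by rewrite !inE.
have := slots_card t; rewrite m2E => H1 H2.
have mN : (4 * m.+1 <= N)%N.
  by apply: leq_trans Nbig; rewrite m2E leq_mul2l /= -[X in (X <= _)%N]muln1 leq_mul2l U0 orbT.
rewrite -(leq_pmul2r (ltn0Sn m)).
apply: leq_trans H2 _; move: H1 mN; set s := #|slots t|.
rewrite (_ : (2 * (2 * M) * s * m.+1 = 2 * (s * (m.+1 * (2 * M))))%N); last by ring.
move: (s * _)%N => z; move: (m.+1) => y; clear; lia.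
Qed.

Let N0 : (0 < N)%N. Proof. by apply: leq_trans Nbig; rewrite muln_gt0. Qed.

Lemma slots_gt0 t : (0 < #|slots t|)%N.
Proof. have := slots_card t; case: #|slots t| => //; move: N0; clear; lia. Qed.

(** Sampling uniformly from a support thus gives point masses of order [1 / N]. On a good slot the
    bound comes from the term [xi] in [good]. *)
Lemma supp_card b t : xi / (4 * m2.+1%:R) * N%:R <= #|supp b t|%:R.
Proof.
have H : 3 * N%:R <= 4 * (#|slots t|%:R * m2.+1%:R) :> R.
  by rewrite -!natrM ler_nat slots_card.
have s0 : 0 < #|slots t|%:R :> R by rewrite ltr0n slots_gt0.
have z0 : 0 < m2.+1%:R :> R by rewrite ltr0n.
have NR : 0 < N%:R :> R by rewrite ltr0n.
have -> : xi / (4 * m2.+1%:R) * N%:R = (xi * N%:R) / (4 * m2.+1%:R) by rewrite mulrAC.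
rewrite ler_pdivrMr ?mulr_gt0 //.
rewrite /supp; case: ifPn => [g|_]; last first.
  have := mulr_gt0 s0 z0; have : xi * N%:R <= N%:R by rewrite ler_piMl // ltW.
  move: H; lra.
have : xi <= 2 * ratio (cellslot b t) (slots t).
  by apply: le_trans g; rewrite lerDr /ratio divr_ge0.
rewrite /ratio mulrA ler_pdivlMr // => H2.
set s := #|cellslot b t|%:R in H2 *.
suff : xi * (#|slots t|%:R * m2.+1%:R) <= 2 * s * m2.+1%:R.
  move: xi0; nra.
by rewrite mulrA ler_pM2r.
Qed.

Lemma supp_gt0 b t : (0 < #|supp b t|)%N.
Proof.
rewrite -(ltr0n R); apply: lt_le_trans (supp_card b t).
by rewrite !mulr_gt0 ?invr_gt0 ?mulr_gt0 ?ltr0n.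
Qed.

Lemma interval_slots a : (#|[pred t | slot_interval t == a]| <= 2 * M)%N.
Proof.
pose f (t : 'I_m2.+1) : 'I_(2 * M) := Ordinal (ltn_pmod t U0).
rewrite -[X in (_ <= X)%N]card_ord -(card_in_imset (f := f)); first exact: max_card.
move=> t s; rewrite !inE => /eqP ta /eqP sa /(congr1 val) /= E.
apply: val_inj => /=; rewrite (divn_eq t (2 * M)) (divn_eq s (2 * M)) E.
by rewrite -!slot_intervalE ta sa.
Qed.

(** A vertex visits [M] of the [2 * M] slots of its interval, each with probability [1 / M]. Summing
    over all of them gives a majorant that does not depend on the offset of the vertex, with total
    mass at most 2. *)
Definition Lam (q : K * 'I_m.+1) (f : 'I_N -> R) : R :=
  (\sum_(t | slot_interval t == q.2) avg (supp q.1 t) f) / M%:R.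

Definition Bad (q : K * 'I_m.+1) : R :=
  #|[pred t | (slot_interval t == q.2) && ~~ good q.1 t]|%:R / M%:R.

Let MR : 0 < M%:R :> R. Proof. by rewrite ltr0n. Qed.

Lemma Lam_le_homo q f h : (forall x, f x <= h x) -> Lam q f <= Lam q h.
Proof.
by move=> fh; rewrite ler_pM2r ?invr_gt0 // ler_sum // => t _; apply: avg_le.
Qed.

Lemma LamD q f h : Lam q (fun x => f x + h x) = Lam q f + Lam q h.
Proof.
rewrite /Lam -mulrDl -big_split /=; congr (_ / _).
by apply: eq_bigr => t _; rewrite avgD.
Qed.

Lemma LamZ q f r : Lam q (fun x => r * f x) = r * Lam q f.
Proof.
rewrite /Lam mulrA mulr_sumr; congr (_ / _).
by apply: eq_bigr => t _; rewrite avgZ.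
Qed.

Lemma Lam_cst q r : 0 <= r -> Lam q (fun=> r) <= 2 * r.
Proof.
move=> r0; rewrite ler_pdivrMr //.
apply: (@le_trans _ _ (\sum_(t | slot_interval t == q.2) r)).
  by apply: ler_sum => t _; apply: avg_cst_le.
rewrite sumr_const -[r *+ _]mulr_natr mulrC mulrAC ler_wpM2r //.
by rewrite -natrM ler_nat interval_slots.
Qed.

Lemma Bad_ge0 q : 0 <= Bad q.
Proof. by rewrite divr_ge0. Qed.

Lemma Bad_le2 q : Bad q <= 2.
Proof.
rewrite ler_pdivrMr // -natrM ler_nat; apply: leq_trans (interval_slots q.2).
by apply/subset_leq_card/subsetP => t; rewrite !inE => /andP[].
Qed.

(** Bad slots are bounded trivially. On a good slot the colour class has at least half its expected
    proportion, a factor 2, and the slot at least [1 / (4 * M)] of the interval, a factor 4. *)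
Lemma Lam_bound q f r : (forall x, 0 <= f x <= r) ->
  Lam q f <= r * Bad q + 8 * avg (cells q) f.
Proof.
case: q => b a f01.
have f0 x : 0 <= f x by case/andP: (f01 x).
have r0 : 0 <= r by case/andP: (f01 (Ordinal N0)) => /le_trans; apply.
rewrite /Lam /Bad /= (bigID (good b)) /= mulrDl addrC; apply: lerD.
  rewrite mulrA ler_pM2r ?invr_gt0 //.
  apply: (@le_trans _ _ (\sum_(t | (slot_interval t == a) && ~~ good b t) r)).
    apply: ler_sum => t _; apply: le_trans (avg_cst_le (supp b t) r0).
    by apply: avg_le => x; case/andP: (f01 x).
  by rewrite sumr_const mulr_natr.
rewrite ler_pdivrMr //.
have tE t : (slot_interval t == a) && good b t ->
    avg (supp b t) f <= (8 * M%:R) / #|cells (b, a)|%:R * \sum_(x in cellslot b t) f x.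
  move=> /andP[/eqP ta gt]; rewrite /avg /supp gt mulrC ler_wpM2r ?sumr_ge0 //.
  have H : ratio (cells (b, a)) (intvl a) + xi <= 2 * ratio (cellslot b t) (slots t).
    by rewrite -ta.
  have s0 : 0 < #|slots t|%:R :> R by rewrite ltr0n slots_gt0.
  have k0 : 0 < #|cellslot b t|%:R :> R.
    rewrite ltr0n lt0n; apply: contraTneq H => /eqP; rewrite -ltNge /ratio => /eqP ->.
    by rewrite mul0r mulr0 ltr_wpDl // divr_ge0.
  have sub : cellslot b t \subset cells (b, a).
    apply/subsetP => v; rewrite !inE => /andP[/eqP<- /eqP vt].
    by rewrite /cell -ta -vt slot_interval_pos.
  have Q0 : 0 < #|cells (b, a)|%:R :> R.
    by apply: lt_le_trans k0 _; rewrite ler_nat subset_leq_card.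
  have I0 : 0 < #|intvl a|%:R :> R.
    apply: lt_le_trans Q0 _; rewrite ler_nat subset_leq_card //.
    by apply/subsetP => v; rewrite !inE => /eqP[_ ->].
  have {}H : ratio (cells (b, a)) (intvl a) <= 2 * ratio (cellslot b t) (slots t).
    by apply: le_trans H; rewrite lerDl ltW.
  have IS : #|intvl a|%:R <= 4 * M%:R * #|slots t|%:R :> R.
    rewrite -!natrM ler_nat; apply: leq_trans (intvl_card a t) _; lia.
  rewrite lter_pdivlMr // mulrC ler_pdivrMr //.
  move: H; rewrite /ratio ler_pdivrMr // mulrA mulrAC ler_pdivlMr // => H.
  rewrite -(ler_pM2r s0); apply: le_trans H _.
  set k := #|cellslot b t|%:R; set I := #|intvl a|%:R; set s := #|slots t|%:R.
  have : 2 * k * I <= 2 * k * (4 * M%:R * s) by rewrite ler_pM2l ?mulr_gt0.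
  by move/le_trans; apply; rewrite le_eqVlt; apply/orP; left; apply/eqP; ring.
apply: (@le_trans _ _ (\sum_(t | (slot_interval t == a) && good b t)
   (8 * M%:R) / #|cells (b, a)|%:R * \sum_(x in cellslot b t) f x)).
  exact: ler_sum.
rewrite -mulr_sumr.
rewrite /avg; set Q := #|cells _|%:R; set Z := (X in 8 * (X / _)).
have -> : 8 * (Z / Q) * M%:R = 8 * M%:R / Q * Z by ring.
rewrite ler_wpM2l ?divr_ge0 ?mulr_ge0 //.
rewrite /Z (partition_big (@pos m2 N) (fun t => slot_interval t == a)) /=; last first.
  by move=> v; rewrite inE slot_interval_pos => /eqP[_ ->].
rewrite [leLHS]big_mkcondr /=; apply: ler_sum => t ta; case: ifP => _; last exact: sumr_ge0.
rewrite le_eqVlt; apply/orP; left; apply/eqP; apply: eq_bigl => v; rewrite !inE /cell.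
have [vt|] := eqVneq (pos m2 v) t; rewrite ?andbF // !andbT xpair_eqE.
by rewrite -slot_interval_pos vt ta andbT.
Qed.

Definition colour_ind (b : K) (v : 'I_N) : R := (c v == b)%:R.

Lemma cexp_pos b v :
  cexp (@pos m N) (colour_ind b) v = ratio (cells (b, pos m v)) (intvl (pos m v)).
Proof.
rewrite /cexp /ratio /colour_ind -natr_sum -big_mkcondr /= sum1_card.
congr (_%:R / _%:R); apply: eq_card => w; rewrite !inE //.
by rewrite -[in LHS]topredE /= /cell xpair_eqE andbC.
Qed.

Lemma cexp_slot b v :
  cexp (@pos m2 N) (colour_ind b) v = ratio (cellslot b (pos m2 v)) (slots (pos m2 v)).
Proof.
rewrite /cexp /ratio /colour_ind -natr_sum -big_mkcondr /= sum1_card.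
congr (_%:R / _%:R); apply: eq_card => w; rewrite !inE //.
by rewrite -[in LHS]topredE /= andbC.
Qed.

(** If a colour has frequency [r] in the interval and [r'] in a bad slot, then
    [r < 2 * (r - r') + xi]. So bad mass is paid for by the change of frequencies from intervals to
    slots. *)
Lemma Bad_sum :
  \sum_q #|cells q|%:R * Bad q <=
  8 * (\sum_b \sum_v `|cexp (@pos m2 N) (colour_ind b) v -
                       cexp (@pos m N) (colour_ind b) v|)
  + 4 * xi * (#|K|%:R * N%:R).
Proof.
pose D b v := `|cexp (@pos m2 N) (colour_ind b) v - cexp (@pos m N) (colour_ind b) v|.
have -> : 8 * (\sum_b \sum_v D b v) + 4 * xi * (#|K|%:R * N%:R) =
   \sum_b \sum_v (8 * D b v + 4 * xi).
  rewrite mulr_sumr.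
  have -> : 4 * xi * (#|K|%:R * N%:R) = \sum_(b : K) \sum_(v : 'I_N) (4 * xi).
    rewrite !sumr_const card_ord -!mulrnA -[RHS]mulr_natr natrM; ring.
  rewrite -big_split /=; apply: eq_bigr => b _.
  by rewrite mulr_sumr -big_split.
rewrite -(pair_bigA _ (fun b a => #|cells (b, a)|%:R * Bad (b, a))) /=.
apply: ler_sum => b _.
rewrite (partition_big (@pos m N) xpredT) //=; apply: ler_sum => a _.
rewrite (partition_big (@pos m2 N) (fun t => slot_interval t == a)) /=; last first.
  by move=> v; rewrite slot_interval_pos.
have -> : Bad (b, a) = \sum_(t | (slot_interval t == a) && ~~ good b t) M%:R^-1.
  rewrite /Bad -sum1_card natr_sum mulr_suml.
  by apply: eq_bigr => t _; rewrite mul1r.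
rewrite mulr_sumr.
rewrite [leLHS]big_mkcondr /=; apply: ler_sum => t ta.
have D0 v : 0 <= 8 * D b v + 4 * xi.
  by rewrite addr_ge0 ?mulr_ge0 ?normr_ge0 ?(ltW xi0).
case: ifPn => bad; last exact: sumr_ge0.
have taE := eqP ta.
rewrite (eq_bigl (fun v => v \in slots t)); last first.
  move=> v; rewrite inE; have [vt|] := eqVneq (pos m2 v) t; rewrite ?andbF // andbT.
  by rewrite -slot_interval_pos vt.
have s0 : 0 < #|slots t|%:R :> R by rewrite ltr0n slots_gt0.
rewrite (eq_bigr (fun=> 8 * `|ratio (cellslot b t) (slots t) - ratio (cells (b, a)) (intvl a)| + 4 * xi)).
  rewrite sumr_const -[leRHS]mulr_natr.
  have sub : slots t \subset intvl a.
    by apply/subsetP => v; rewrite !inE -taE => /eqP<-; rewrite slot_interval_pos.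
  have I0 : 0 < #|intvl a|%:R :> R.
    by apply: lt_le_trans s0 _; rewrite ler_nat subset_leq_card.
  have IS : #|intvl a|%:R <= 4 * M%:R * #|slots t|%:R :> R.
    rewrite -!natrM ler_nat; apply: leq_trans (intvl_card a t) _; lia.
  have QI : #|cells (b, a)|%:R = ratio (cells (b, a)) (intvl a) * #|intvl a|%:R :> R.
    by rewrite /ratio divfK // gt_eqF.
  move: bad; rewrite /good -ltNge taE QI.
  set r := ratio (cells _) _; set r' := ratio (cellslot _ _) _ => bad.
  have r0 : 0 <= r by rewrite /r /ratio divr_ge0.
  apply: (@le_trans _ _ (r * (4 * #|slots t|%:R))).
    rewrite -[leLHS]mulrA ler_wpM2l // ler_pdivrMr //; move: IS; lra.
  rewrite [leRHS]mulrC mulrA [leLHS]mulrC ler_pM2l //.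
  have := ler_norm (r - r'); rewrite distrC.
  move: bad; lra.
move=> v; rewrite inE => /eqP vt; rewrite /D cexp_slot cexp_pos vt.
by rewrite -slot_interval_pos vt taE.
Qed.

End Slots.

(** * Random increasing maps *)

Section Sampling.
Context {R : realFieldType} {Sigma K : finType}.
Variables (m M m2 N n : nat) (c : 'I_N -> K) (xi : R).
Hypothesis M0 : (0 < M)%N.
Hypothesis m2E : m2.+1 = (m.+1 * (2 * M))%N.
Hypothesis Nbig : (4 * m2.+1 <= N)%N.
Hypothesis xi0 : 0 < xi.
Hypothesis xi1 : xi <= 1.
Hypothesis nM : (n <= M)%N.
Variable (ch : 'I_n -> K).

Implicit Types (u : {ffun 'I_m.+1 -> 'I_M}) (i j : 'I_n).

(** The shift [y] and the label [i] are both below [M], hence [2 * M] slots per interval. Adding the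
    label puts successive vertices into successive slots. *)
Definition slot_at (i : 'I_n) (y : 'I_M) : 'I_m2.+1 :=
  inord (pos m i * (2 * M) + (y + i)).

Lemma slot_at_lt (i : 'I_n) (y : 'I_M) : (y + i < 2 * M)%N.
Proof. by have := ltn_ord i; have := ltn_ord y; move: nM; lia. Qed.

Lemma slot_atE (i : 'I_n) (y : 'I_M) :
  slot_at i y = (pos m i * (2 * M) + (y + i))%N :> nat.
Proof.
rewrite inordK // m2E.
have lt := slot_at_lt i y.
apply: (@leq_trans ((pos m i).+1 * (2 * M))).
  by rewrite mulSn addnC ltn_add2r.
by rewrite leq_mul2r ltn_ord orbT.
Qed.

Lemma slot_at_interval i y : slot_interval m M (slot_at i y) = pos m i.
Proof.
apply: val_inj; rewrite /= (slot_intervalE M0 m2E) slot_atE.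
by rewrite divnMDl ?muln_gt0 // divn_small ?addn0 // slot_at_lt.
Qed.

Lemma slot_at_inj i : injective (slot_at i).
Proof.
move=> y z /(congr1 val) /=; rewrite !slot_atE => E; apply: val_inj => /=; lia.
Qed.

Definition slot_of u i : 'I_m2.+1 := slot_at i (u (pos m i)).

Lemma slot_of_incr u i j : (i < j)%N -> (slot_of u i < slot_of u j)%N.
Proof.
move=> ij; rewrite !slot_atE.
have := pos_mono m (ltnW ij); rewrite leq_eqVlt => /orP[/eqP/val_inj->|lt].
  by rewrite !ltn_add2l.
have H := slot_at_lt i (u (pos m i)); apply: (@leq_trans ((pos m i).+1 * (2 * M))).
  by rewrite mulSn addnC ltn_add2r.
by apply: leq_trans (leq_addr _ _); rewrite leq_mul2r lt orbT.
Qed.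

Definition supp_of u i : {set 'I_N} := supp m M c xi (ch i) (slot_of u i).

Lemma supp_of_sep u i j x y : (i < j)%N ->
  x \in supp_of u i -> y \in supp_of u j -> (x < y)%N.
Proof.
move=> ij /(subsetP (supp_sub _ _ _ _ _ _)); rewrite inE => /eqP xs.
move=> /(subsetP (supp_sub _ _ _ _ _ _)); rewrite inE => /eqP ys.
rewrite ltnNge; apply/negP => /(pos_mono m2); rewrite xs ys.
by rewrite leqNgt slot_of_incr.
Qed.

Definition law u i (x : 'I_N) : R := (x \in supp_of u i)%:R / #|supp_of u i|%:R.

Lemma supp_of_gt0 u i : 0 < #|supp_of u i|%:R :> R.
Proof. by rewrite ltr0n; apply: supp_gt0. Qed.

Lemma law_sum u i : \sum_x law u i x = 1.
Proof.
rewrite /law -mulr_suml -natr_sum -big_mkcond /= sum1_card divff //.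
by rewrite gt_eqF // supp_of_gt0.
Qed.

Lemma law_ge0 u i x : 0 <= law u i x.
Proof. by rewrite divr_ge0. Qed.

Definition expect u (Phi : {ffun 'I_n -> 'I_N} -> R) : R :=
  \sum_(X : {ffun 'I_n -> 'I_N}) \prod_i law u i (X i) * Phi X.

Lemma expect_pair u i j (Z : 'I_N -> 'I_N -> R) : i != j ->
  expect u (fun X => Z (X i) (X j)) =
  avg (supp_of u i) (fun x => avg (supp_of u j) (Z x)).
Proof.
move=> ij; rewrite /expect (sum_ffun_pair Z ij (law_sum u)).
rewrite -(@sum_avg _ _ _ _ (law u i)) //; apply: eq_bigr => x _.
rewrite -(@sum_avg _ _ _ _ (law u j)) // mulr_sumr.
by apply: eq_bigr => y _; rewrite mulrA.
Qed.

(** Mean over independent uniform shifts, one per interval. The weight is left as a product so that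
    the lemmas on product weights apply. *)
Definition meanu (Phi : {ffun 'I_m.+1 -> 'I_M} -> R) : R :=
  \sum_(u : {ffun 'I_m.+1 -> 'I_M}) \prod_(a < m.+1) M%:R^-1 * Phi u.

Let MR : 0 < M%:R :> R. Proof. by rewrite ltr0n. Qed.

Let unif1 : forall a : 'I_m.+1, \sum_(y < M) M%:R^-1 = 1 :> R.
Proof. by move=> a; rewrite sumr_const card_ord -[LHS]mulr_natr mulVf // gt_eqF. Qed.

Lemma sum_slot_at i (f : 'I_N -> R) : (forall x, 0 <= f x) ->
  \sum_(y < M) M%:R^-1 * avg (supp m M c xi (ch i) (slot_at i y)) f
  <= Lam M m2 c xi (ch i, pos m i) f.
Proof.
move=> f0; rewrite -mulr_sumr mulrC /Lam ler_pM2r ?invr_gt0 //=.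
have -> : \sum_(y < M) avg (supp m M c xi (ch i) (slot_at i y)) f =
          \sum_(t in [set slot_at i y | y : 'I_M]) avg (supp m M c xi (ch i) t) f.
  rewrite big_imset; last by move=> y z _ _; apply: slot_at_inj.
  by apply: eq_bigl => y; rewrite inE.
rewrite [leRHS]big_mkcond [leLHS]big_mkcond; apply: ler_sum => t _ /=.
case: ifP => [/imsetP[y _ ->]|_]; first by rewrite slot_at_interval eqxx.
by case: ifP => // _; apply: avg_ge0.
Qed.

(** Distinct intervals have independent shifts, so the mean splits into two averages over single
    vertices, each dominated by [Lam]. *)
Lemma mean_pair i j (Z : 'I_N -> 'I_N -> R) :
  (forall x y, 0 <= Z x y) -> pos m i != pos m j ->
  meanu (fun u => expect u (fun X => Z (X i) (X j))) <=
  Lam M m2 c xi (ch i, pos m i) (fun x => Lam M m2 c xi (ch j, pos m j) (Z x)).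
Proof.
move=> Z0 pij; have ij : i != j by apply: contraNneq pij => ->.
pose S i y := supp m M c xi (ch i) (slot_at i y).
rewrite /meanu (eq_bigr (fun u => \prod_(a < m.+1) M%:R^-1 *
   avg (S i (u (pos m i))) (fun x => avg (S j (u (pos m j))) (Z x)))); last first.
  by move=> u _; rewrite expect_pair.
rewrite (sum_ffun_pair (p := fun _ _ => M%:R^-1)
  (fun y z => avg (S i y) (fun x => avg (S j z) (Z x))) pij unif1).
apply: (@le_trans _ _ (\sum_(y < M) M%:R^-1 *
   avg (S i y) (fun x => Lam M m2 c xi (ch j, pos m j) (Z x)))); last first.
  apply: sum_slot_at => x; rewrite divr_ge0 // sumr_ge0 // => t _.
  exact: avg_ge0.
apply: ler_sum => y _.
under eq_bigr do rewrite -mulrA -avgZ.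
rewrite -mulr_sumr -avg_sum ler_pM2l ?invr_gt0 //; apply: avg_le => x.
exact: sum_slot_at.
Qed.

Lemma mean_pair_bound i j (Z : 'I_N -> 'I_N -> R) :
  (forall x y, 0 <= Z x y <= 1) -> pos m i != pos m j ->
  meanu (fun u => expect u (fun X => Z (X i) (X j))) <=
  8 * Bad M m2 c xi (ch i, pos m i) + 2 * Bad M m2 c xi (ch j, pos m j) +
  64 * avg (cells c (ch i, pos m i)) (fun x => avg (cells c (ch j, pos m j)) (Z x)).
Proof.
move=> Z01 pij.
have Z0 x y : 0 <= Z x y by case/andP: (Z01 x y).
set qi := (ch i, _); set qj := (ch j, _).
apply: le_trans (mean_pair Z0 pij) _.
pose h x := avg (cells c qj) (Z x).
have h01 x : 0 <= h x <= 1.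
  rewrite avg_ge0 //=; apply: le_trans (avg_cst_le (cells c qj) ler01).
  by apply: avg_le => y; case/andP: (Z01 x y).
(* Bound the inner average first. The outer one has mass at most 2, which gives the 2 before [Bad],
   and contributes another factor 8 to [h]. *)
apply: (@le_trans _ _ (Lam M m2 c xi qi (fun x => Bad M m2 c xi qj + 8 * h x))).
  apply: Lam_le_homo => // x.
  by have := Lam_bound c M0 m2E Nbig xi0 xi1 qj (Z01 x); rewrite mul1r.
rewrite LamD LamZ.
have H1 := Lam_cst c xi M0 m2E qi (Bad_ge0 M m2 c xi qj).
have H2 := Lam_bound c M0 m2E Nbig xi0 xi1 qi h01.
move: H1 H2; rewrite -/h; lra.
Qed.

Lemma expect_sum u (I : finType) (P : pred I) (Phi : I -> {ffun 'I_n -> 'I_N} -> R) :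
  expect u (fun X => \sum_(i | P i) Phi i X) = \sum_(i | P i) expect u (Phi i).
Proof.
rewrite /expect exchange_big /=; apply: eq_bigr => X _.
by rewrite mulr_sumr.
Qed.

Lemma expect_le u (Phi Psi : {ffun 'I_n -> 'I_N} -> R) :
  (forall X, Phi X <= Psi X) -> expect u Phi <= expect u Psi.
Proof.
move=> le; apply: ler_sum => X _; rewrite ler_wpM2l // prodr_ge0 // => i _.
exact: law_ge0.
Qed.

Lemma expect_cst u r : expect u (fun=> r) = r.
Proof.
by rewrite /expect -mulr_suml (sum_ffun_one (law_sum u)) mul1r.
Qed.

Lemma meanu_sum (I : finType) (P : pred I) (Phi : I -> {ffun 'I_m.+1 -> 'I_M} -> R) :
  meanu (fun u => \sum_(i | P i) Phi i u) = \sum_(i | P i) meanu (Phi i).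
Proof.
rewrite /meanu exchange_big /=; apply: eq_bigr => X _.
by rewrite mulr_sumr.
Qed.

Lemma meanu_le (Phi Psi : {ffun 'I_m.+1 -> 'I_M} -> R) :
  (forall u, Phi u <= Psi u) -> meanu Phi <= meanu Psi.
Proof.
move=> le; apply: ler_sum => u _; rewrite ler_wpM2l // prodr_ge0 // => i _.
by rewrite invr_ge0.
Qed.

Lemma meanu_cst r : meanu (fun=> r) = r.
Proof.
rewrite /meanu -mulr_suml.
by rewrite (sum_ffun_one (p := fun=> fun=> M%:R^-1) unif1) mul1r.
Qed.

(** Pairs inside one interval share their shift and are charged the full cost 1, which gives the
    first term. The others fall under [mean_pair_bound], and 10 is [8 + 2]. *)
Lemma mean_cost (h : 'I_n -> 'I_n -> Sigma) (Z : Sigma -> 'I_N -> 'I_N -> R) :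
  (forall s x y, 0 <= Z s x y <= 1) ->
  meanu (fun u => expect u (fun X =>
    \sum_(p : 'I_n * 'I_n | (p.1 < p.2)%N) Z (h p.1 p.2) (X p.1) (X p.2))) <=
  (n%:R * (n%:R + m.+1%:R)) / m.+1%:R
  + 10 * n%:R * (\sum_i Bad M m2 c xi (cell m ch i))
  + 64 * \sum_(p : 'I_n * 'I_n) avg (cells c (cell m ch p.1))
      (fun x => avg (cells c (cell m ch p.2)) (Z (h p.1 p.2) x)).
Proof.
move=> Z01.
pose B i : R := Bad M m2 c xi (cell m ch i).
pose A (p : 'I_n * 'I_n) := avg (cells c (cell m ch p.1))
      (fun x => avg (cells c (cell m ch p.2)) (Z (h p.1 p.2) x)).
have A0 p : 0 <= A p.
  by apply: avg_ge0 => x; apply: avg_ge0 => y; case/andP: (Z01 (h p.1 p.2) x y).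
have B0 i : 0 <= B i by exact: Bad_ge0.
under [X in meanu X]boolp.funext => u do rewrite expect_sum.
rewrite meanu_sum.
apply: (@le_trans _ _ (\sum_(p : 'I_n * 'I_n)
    ((pos m p.1 == pos m p.2)%:R + (8 * B p.1 + 2 * B p.2) + 64 * A p))).
  rewrite [leLHS]big_mkcond; apply: ler_sum => -[i j] _ /=.
  have R0 : 0 <= (pos m i == pos m j)%:R + (8 * B i + 2 * B j) + 64 * A (i, j).
    have := A0 (i, j); have := B0 i; have := B0 j.
    have : 0 <= (pos m i == pos m j)%:R :> R by rewrite ler0n.
    lra.
  case: ifP => // ij; have [E|ne] := boolP (pos m i == pos m j); last first.
    rewrite add0r; apply: mean_pair_bound ne => x y; exact: Z01.
  apply: (@le_trans _ _ 1); last first.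
    by rewrite mulr1n; have := A0 (i, j); have := B0 i; have := B0 j; lra.
  rewrite -[leRHS]meanu_cst; apply: meanu_le => u.
  rewrite -[leRHS](expect_cst u); apply: expect_le => X.
  by case/andP: (Z01 (h i j) (X i) (X j)).
rewrite !big_split /= -!mulr_sumr.
rewrite -(pair_bigA _ (fun i _ => B i)) -(pair_bigA _ (fun _ j => B j)) /=.
rewrite -(pair_bigA _ (fun i j => (pos m i == pos m j)%:R)) /=.
have -> : \sum_(i < n) \sum_(j < n) B i = n%:R * \sum_i B i.
  by rewrite mulr_sumr; apply: eq_bigr => i _; rewrite sumr_const card_ord mulr_natl.
have -> : \sum_(i < n) \sum_(j < n) B j = n%:R * \sum_i B i.
  by rewrite sumr_const card_ord mulr_natl.
rewrite !lerD //; last by rewrite -/B; lra.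
rewrite ler_pdivlMr ?ltr0n // mulr_suml.
apply: (@le_trans _ _ (\sum_(i < n) (n%:R + m.+1%:R))); last first.
  by rewrite sumr_const card_ord mulr_natl.
apply: ler_sum => i _.
have := pos_fiber_le n (pos m i).
rewrite -(ler_nat R) natrM natrD; apply: le_trans.
rewrite -natr_sum -big_mkcond /= sum1_card ler_pM2r ?ltr0n // ler_nat.
apply/subset_leq_card/subsetP => j.
by rewrite -[in X in X -> _]topredE /= inE eq_sym.
Qed.

End Sampling.

(** * Transfer of type frequencies from one graph to another *)

Lemma sum_fibers (R : realFieldType) (I J : finType) (k : I -> J) (Phi : J -> R) :
  \sum_i Phi (k i) = \sum_j #|[set i | k i == j]|%:R * Phi j.
Proof.
rewrite (partition_big k xpredT) //=; apply: eq_bigr => j _.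
rewrite -sum1_card natr_sum mulr_suml.
by apply: eq_big => [i|i /eqP ->]; rewrite ?inE ?mul1r.
Qed.

Definition triple (Sigma Q : finType) n (h : 'I_n -> 'I_n -> Sigma) (cl : 'I_n -> Q)
  (p : 'I_n * 'I_n) : Sigma * Q * Q := (h p.1 p.2, cl p.1, cl p.2).

Lemma avg_cells_cexp (R : realFieldType) (K : finType) m N (c : 'I_N -> K)
    (Z : 'I_N -> 'I_N -> R) (p : 'I_N * 'I_N) :
  avg (cells c (cell m c p.1)) (fun x => avg (cells c (cell m c p.2)) (Z x)) =
  cexp (pcol (cell m c)) (fun p => Z p.1 p.2) p.
Proof.
rewrite /avg /cexp -mulr_suml.
have E (q : 'I_N * 'I_N) : (pcol (cell m c) q == pcol (cell m c) p) =
   (q.1 \in cells c (cell m c p.1)) && (q.2 \in cells c (cell m c p.2)).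
  by rewrite xpair_eqE !inE.
rewrite (eq_bigl _ _ E) (eq_card (B := [pred q | (q.1 \in cells c (cell m c p.1)) &&
  (q.2 \in cells c (cell m c p.2))])) => [|q]; last by rewrite inE E.
rewrite -(pair_big (mem (cells c (cell m c p.1))) (mem (cells c (cell m c p.2))) Z) /=.
rewrite (cardX (mem (cells c (cell m c p.1))) (mem (cells c (cell m c p.2)))).
by rewrite natrM invfM [RHS]mulrA [RHS]mulrAC.
Qed.

(** The summands in [mean_cost] depend only on the cell of a vertex or the [triple] of a pair. These
    frequencies in the small graph exceed those in the large one by at most [zeta], so the sums can
    be taken over the large graph. *)
Lemma table_cost (R : realFieldType) (Sigma K : finType) (m M m2 N n : nat)
    (c : 'I_N -> K) (ch : 'I_n -> K) (xi zeta : R)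
    (g : 'I_N -> 'I_N -> Sigma) (h : 'I_n -> 'I_n -> Sigma)
    (Z : Sigma -> 'I_N -> 'I_N -> R) :
  (0 < M)%N -> m2.+1 = (m.+1 * (2 * M))%N -> (4 * m2.+1 <= N)%N ->
  0 < xi -> xi <= 1 -> 0 <= zeta -> (n <= M)%N -> (0 < n)%N ->
  (forall s x y, 0 <= Z s x y <= 1) ->
  (forall q : K * 'I_m.+1, #|cells ch q|%:R / n%:R <= #|cells c q|%:R / N%:R + zeta) ->
  (forall t : Sigma * (K * 'I_m.+1) * (K * 'I_m.+1),
     #|[set p | triple h (cell m ch) p == t]|%:R / n%:R ^+ 2 <=
     #|[set p | triple g (cell m c) p == t]|%:R / N%:R ^+ 2 + zeta) ->
  meanu (fun u : {ffun 'I_m.+1 -> 'I_M} => expect m2 c xi ch u (fun X =>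
    \sum_(p : 'I_n * 'I_n | (p.1 < p.2)%N) Z (h p.1 p.2) (X p.1) (X p.2))) <=
  n%:R ^+ 2 * (m.+1%:R^-1 + n%:R^-1 +
    10 * (8 * ((\sum_b \sum_v `|cexp (@pos m2 N) (colour_ind c b) v -
                       cexp (@pos m N) (colour_ind c b) v|) / N%:R)
         + 4 * xi * #|K|%:R + 2 * zeta * #|{: K * 'I_m.+1}|%:R) +
    64 * (zeta * #|{: Sigma * (K * 'I_m.+1) * (K * 'I_m.+1)}|%:R +
       (\sum_s \sum_p dens g (cell m c) s p * Z s p.1 p.2) / N%:R ^+ 2)).
Proof.
move=> M0 m2E Nbig xi0 xi1 z0 nM n0 Z01 HQ HT.
apply: le_trans (mean_cost c M0 m2E Nbig xi0 xi1 nM ch h Z01) _.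
have N0 : 0 < N%:R :> R.
  by rewrite ltr0n; apply: leq_trans Nbig; rewrite muln_gt0.
have nR : 0 < n%:R :> R by rewrite ltr0n.
have mR : 0 < m.+1%:R :> R by rewrite ltr0n.
set D := \sum_b _.
have H1 : \sum_i Bad M m2 c xi (cell m ch i) <= n%:R *
   ((8 * D / N%:R + 4 * xi * #|K|%:R) + 2 * zeta * #|{: K * 'I_m.+1}|%:R).
  rewrite (sum_fibers (cell m ch) (fun q => Bad M m2 c xi q)).
  (* Each cell adds an error of at most [2 * zeta], since [Bad] is at most 2. *)
  apply: (@le_trans _ _ (n%:R * \sum_q ((#|cells c q|%:R * Bad M m2 c xi q) / N%:R + 2 * zeta))).
    rewrite mulr_sumr; apply: ler_sum => q _.
    have B0 := Bad_ge0 M m2 c xi q; have B2 := Bad_le2 c xi M0 m2E q.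
    have := HQ q; rewrite ler_pdivrMr // mulrC => le.
    have {le} := ler_wpM2r B0 le; rewrite /cells => /le_trans; apply.
    rewrite -[leLHS]mulrA ler_wpM2l ?(ltW nR) // mulrDl [_ / _ * Bad _ _ _ _ _]mulrAC lerD2l mulrC.
    exact: ler_wpM2r.
  rewrite ler_pM2l // big_split /= sumr_const -[X in _ + X <= _]mulr_natr lerD //.
  rewrite -mulr_suml ler_pdivrMr // mulrDl divfK ?gt_eqF //.
  by have := Bad_sum c M0 m2E Nbig xi0 xi1; rewrite -/D mulrA.
pose A (t : Sigma * (K * 'I_m.+1) * (K * 'I_m.+1)) :=
  avg (cells c t.1.2) (fun x => avg (cells c t.2) (Z t.1.1 x)).
have A01 t : 0 <= A t <= 1.
  rewrite avg_ge0 //= => [|x]; last first.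
    by apply: avg_ge0 => y; case/andP: (Z01 t.1.1 x y).
  apply: le_trans (avg_cst_le (cells c t.1.2) ler01); apply: avg_le => x.
  apply: le_trans (avg_cst_le (cells c t.2) ler01); apply: avg_le => y.
  by case/andP: (Z01 t.1.1 x y).
have H2 : \sum_(p : 'I_n * 'I_n) A (triple h (cell m ch) p) <= n%:R ^+ 2 *
   (zeta * #|{: Sigma * (K * 'I_m.+1) * (K * 'I_m.+1)}|%:R +
       (\sum_s \sum_p dens g (cell m c) s p * Z s p.1 p.2) / N%:R ^+ 2).
  (* Move the conditional expectation from the indicator to [Z]; then only the actual colour of a
     pair survives the sum over [s]. *)
  have -> : \sum_s \sum_p dens g (cell m c) s p * Z s p.1 p.2 =
            \sum_p A (triple g (cell m c) p).
    under eq_bigr do rewrite cexp_adj.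
    rewrite exchange_big /=; apply: eq_bigr => p _.
    rewrite (bigD1 (g p.1 p.2)) //= /has_col eqxx mul1r big1 ?addr0.
      by rewrite -avg_cells_cexp.
    by move=> s; rewrite eq_sym => /negbTE->; rewrite mul0r.
  rewrite !(sum_fibers _ A) mulr_suml.
  have -> : zeta * #|{: Sigma * (K * 'I_m.+1) * (K * 'I_m.+1)}|%:R =
    \sum_(t : Sigma * (K * 'I_m.+1) * (K * 'I_m.+1)) zeta.
    by rewrite sumr_const mulr_natr.
  rewrite -big_split /= mulr_sumr; apply: ler_sum => t _.
  case/andP: (A01 t) => A0 A1.
  have := HT t; rewrite ler_pdivrMr ?exprn_gt0 // mulrC => le.
  have {le} := ler_wpM2r A0 le => /le_trans; apply.
  rewrite -[leLHS]mulrA ler_pM2l ?exprn_gt0 // mulrDl [leLHS]addrC.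
  by apply: lerD; [rewrite ler_piMr | rewrite mulrAC].
have -> : n%:R * (n%:R + m.+1%:R) / m.+1%:R = n%:R ^+ 2 * (m.+1%:R^-1 + n%:R^-1) :> R.
  by rewrite !mulrDr mulrDl !expr2 !mulfK ?gt_eqF.
have H1' : 10 * n%:R * \sum_i Bad M m2 c xi (cell m ch i) <= n%:R ^+ 2 *
   (10 * (8 * (D / N%:R) + 4 * xi * #|K|%:R + 2 * zeta * #|{: K * 'I_m.+1}|%:R)).
  have := ler_wpM2l (_ : 0 <= 10 * n%:R) H1.
  move=> /(_ (mulr_ge0 _ (ltW nR)))/le_trans; apply => //.
  by rewrite le_eqVlt; apply/orP; left; apply/eqP; ring.
rewrite [X in _ + 64 * X <= _](_ : _ = \sum_p A (triple h (cell m ch) p)) //.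
move: H1' H2; set S1 := \sum_i _; set S2 := \sum_p _; set S3 := \sum_s _.
rewrite -/D; move: (n%:R ^+ 2) => n2; move: (10 * n%:R * _) => x.
move: (10 * _) => y; move: (zeta * _ + _) => z; move: (_^-1 + _) => w.
by rewrite !mulrDr; lra.
Qed.

(** * Repairing the bounded graph *)

Lemma exists_le_mean (R : realFieldType) (T : finType) (w f : T -> R) :
  (forall x, 0 <= w x) -> \sum_x w x = 1 -> exists x, f x <= \sum_y w y * f y.
Proof.
move=> w0 w1; set b := \sum_y _; apply: boolp.contrapT => H.
have lt x : b < f x by rewrite ltNge; apply/negP => le; apply: H; exists x.
have S0 : \sum_y w y * (f y - b) = 0.
  under eq_bigr do rewrite mulrBr.
  by rewrite sumrB -mulr_suml w1 mul1r subrr.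
have nn y : true -> 0 <= w y * (f y - b) by move=> _; rewrite mulr_ge0 // subr_ge0 ltW.
have W y : w y = 0.
  have /eqP := S0; rewrite psumr_eq0 // => /allP/(_ y (mem_index_enum y)) /=.
  rewrite mulf_eq0 => /orP[/eqP//|]; rewrite subr_eq0 => /eqP E.
  by have := lt y; rewrite E ltxx.
by move: w1; rewrite big1 // => /esym/eqP; rewrite oner_eq0.
Qed.

Section Repair.
Context {R : realFieldType} {Sigma K K' : finType}.
Variables (s0 : Sigma) (Fam : graph_family Sigma).
Variables (m M m2 N n : nat) (c : 'I_N -> K) (c' : 'I_N -> K') (ch : 'I_n -> K).
Variables (G : ordgraph Sigma N) (H : ordgraph Sigma n) (xi eta delta : R).
Hypothesis M0 : (0 < M)%N.
Hypothesis m2E : m2.+1 = (m.+1 * (2 * M))%N.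
Hypothesis Nbig : (4 * m2.+1 <= N)%N.
Hypothesis xi0 : 0 < xi.
Hypothesis xi1 : xi <= 1.
Hypothesis nM : (n <= M)%N.
Hypothesis eta0 : 0 <= eta.
Hypothesis reg : cut_regular (ecol s0 G) c' eta.

Let alpha : R := xi / (4 * m2.+1%:R).

Let alpha0 : 0 < alpha.
Proof. by rewrite divr_gt0 ?mulr_gt0 ?ltr0n. Qed.

Let N0 : 0 < N%:R :> R.
Proof. by rewrite ltr0n; apply: leq_trans Nbig; rewrite muln_gt0. Qed.

(** Replace each law by its bound [1 / (alpha * N)] on the support. Then [counting] exchanges
    densities for colours, and [weighted_copies_le] leaves the number of copies of [F]. *)
Lemma expect_copies (u : {ffun 'I_m.+1 -> 'I_M}) q (F : ordgraph Sigma q)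
    (f : 'I_q -> 'I_n) :
  (forall a b : 'I_q, (a < b)%N -> (f a < f b)%N) ->
  #|induced_copies F G|%:R <= delta * N%:R ^+ q ->
  expect m2 c xi ch u (fun X => \prod_(p : 'I_q * 'I_q | (p.1 < p.2)%N)
     dens (ecol s0 G) c' (ecol s0 F p.1 p.2) (X (f p.1), X (f p.2))) <=
  alpha^-1 ^+ q * (delta + (q ^ 2)%:R * eta).
Proof.
move=> incr few.
have finj : injective f.
  move=> a b; case: (ltngtP a b) => [/incr|/incr|/val_inj //] lt E;
    by rewrite E ltnn in lt.
pose S a := supp_of m2 c xi ch u (f a).
have S0 a : 0 < #|S a|%:R :> R by exact: supp_of_gt0.
pose P (z : {ffun 'I_q -> 'I_N}) : R := \prod_(p : 'I_q * 'I_q | (p.1 < p.2)%N)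
     dens (ecol s0 G) c' (ecol s0 F p.1 p.2) (z p.1, z p.2).
have P0 z : 0 <= P z by apply: prodr_ge0 => p _; exact: dens_ge0.
rewrite /expect (eq_bigr (fun X : {ffun 'I_n -> 'I_N} =>
   \prod_i law m2 c xi ch u i (X i) * P [ffun j => X (f j)])); last first.
  by move=> X _; congr (_ * _); apply: eq_bigr => p _; rewrite !ffunE.
rewrite (sum_ffun_marginal P finj); last by move=> i; exact: law_sum.
have aN : 0 < alpha * N%:R by rewrite mulr_gt0.
apply: (@le_trans _ _ ((alpha * N%:R)^-1 ^+ q *
   \sum_(z : {ffun 'I_q -> 'I_N}) \prod_a (z a \in S a)%:R * P z)).
  rewrite mulr_sumr; apply: ler_sum => z _; rewrite mulrA ler_wpM2r //.
  have -> : (alpha * N%:R)^-1 ^+ q = \prod_(a < q) (alpha * N%:R)^-1.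
    by rewrite prodr_const card_ord.
  rewrite -big_split /=; apply: ler_prod => a _; rewrite law_ge0 /= /law -/(S a) mulrC.
  rewrite ler_wpM2r // lef_pV2 ?posrE //.
  exact: supp_card.
have step : \sum_(z : {ffun 'I_q -> 'I_N}) \prod_a (z a \in S a)%:R * P z <=
   (delta + (q ^ 2)%:R * eta) * N%:R ^+ q.
  apply: le_trans (counting reg eta0 (ecol s0 F) (w := fun a v => (v \in S a)%:R) _) _.
    by move=> a v; rewrite ler0n lern1 leq_b1.
  rewrite mulrDl card_ord lerD2r; apply: le_trans few.
  apply: weighted_copies_le => a b x y ab; apply: (supp_of_sep M0 m2E) => //.
  exact: incr.
apply: le_trans (ler_wpM2l _ step) _; first by rewrite exprn_ge0 // invr_ge0 ltW.
have NN : N%:R^-1 ^+ q * N%:R ^+ q = 1 :> R.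
  by rewrite exprVn mulVf // expf_neq0 // gt_eqF.
by rewrite invfM exprMn mulrACA NN mulr1.
Qed.

Variables (tau cost kap : R).
Hypothesis tau0 : 0 < tau.
Hypothesis tau1 : tau * #|Sigma|%:R <= 1.
Hypothesis few : forall q (F : ordgraph Sigma q), (q <= n)%N -> Fam F ->
  #|induced_copies F G|%:R <= delta * N%:R ^+ q.
Hypothesis few_kap :
  \sum_(U : {set 'I_n}) \sum_(F : ordgraph Sigma #|U|)
    tau^-1 ^+ (#|U| ^ 2) * (alpha^-1 ^+ #|U| * (delta + (#|U| ^ 2)%:R * eta)) <= kap.
Hypothesis delta0 : 0 <= delta.
Hypothesis n0 : (0 < n)%N.

Definition rare (s : Sigma) (x y : 'I_N) : R :=
  (dens (ecol s0 G) c' s (x, y) < tau)%R%:R.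

Hypothesis mean_rare :
  meanu (fun u : {ffun 'I_m.+1 -> 'I_M} => expect m2 c xi ch u (fun X =>
    \sum_(p : 'I_n * 'I_n | (p.1 < p.2)%N)
       rare (ecol s0 H p.1 p.2) (X p.1) (X p.2))) <= n%:R ^+ 2 * cost.
Hypothesis cost1 : cost + kap < 1.

Let tauV : 1 <= tau^-1.
Proof.
rewrite invf_ge1 //; apply: le_trans tau1; apply: ler_peMr; first exact: ltW.
by rewrite ler1n; apply/card_gt0P; exists s0.
Qed.

(** Normalised to be at least 1 when every pair of [U] has density at least [tau] in the colour
    prescribed by [F]. *)
Let copyweight (U : {set 'I_n}) (F : ordgraph Sigma #|U|) (X : {ffun 'I_n -> 'I_N}) : R :=
  tau^-1 ^+ (#|U| ^ 2) * \prod_(p : 'I_#|U| * 'I_#|U| | (p.1 < p.2)%N)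
     dens (ecol s0 G) c' (ecol s0 F p.1 p.2) (X (enum_val p.1), X (enum_val p.2)).

Let copyweight0 U F X : 0 <= @copyweight U F X.
Proof.
rewrite mulr_ge0 ?exprn_ge0 ?invr_ge0 ?(ltW tau0) // prodr_ge0 // => p _.
exact: dens_ge0.
Qed.

(** The factor [n%:R ^+ 2] makes one surviving member of the family dearer than the whole budget, as
    [cost + kap < 1]. *)
Let total (X : {ffun 'I_n -> 'I_N}) : R :=
  \sum_(p : 'I_n * 'I_n | (p.1 < p.2)%N) rare (ecol s0 H p.1 p.2) (X p.1) (X p.2) +
  n%:R ^+ 2 * \sum_(U : {set 'I_n}) \sum_(F : ordgraph Sigma #|U| | boolp.asbool (Fam F))
     copyweight F X.

Lemma enum_val_lt (U : {set 'I_n}) (a b : 'I_#|U|) :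
  (a < b)%N -> (enum_val a < enum_val b)%N.
Proof.
move=> ab; have x0 := enum_val a; rewrite !(enum_val_nth x0).
have := enum_set_sorted U => /(sortedP x0)_.
by apply: (sorted_ltn_nth _ x0 (enum_set_sorted U)) => //;
  [move=> x y z; apply: ltn_trans | rewrite inE -cardE..].
Qed.

Lemma exists_total : exists X, total X <= n%:R ^+ 2 * (cost + kap).
Proof.
have mean_total : meanu (fun u : {ffun 'I_m.+1 -> 'I_M} =>
    expect m2 c xi ch u total) <= n%:R ^+ 2 * (cost + kap).
  pose T1 X : R := \sum_(p : 'I_n * 'I_n | (p.1 < p.2)%N) rare (ecol s0 H p.1 p.2) (X p.1) (X p.2).
  apply: (@le_trans _ _ (meanu (fun u : {ffun 'I_m.+1 -> 'I_M} =>
     expect m2 c xi ch u T1 + n%:R ^+ 2 * kap))); last first.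
    have -> : meanu (fun u : {ffun 'I_m.+1 -> 'I_M} => expect m2 c xi ch u T1 + n%:R ^+ 2 * kap) =
      meanu (fun u : {ffun 'I_m.+1 -> 'I_M} => expect m2 c xi ch u T1) +
      meanu (fun _ : {ffun 'I_m.+1 -> 'I_M} => n%:R ^+ 2 * kap).
      by rewrite /meanu -big_split; apply: eq_bigr => u _; rewrite mulrDr.
    by rewrite meanu_cst // mulrDr lerD2r.
  apply: meanu_le => u.
  have -> : expect m2 c xi ch u total = expect m2 c xi ch u T1 + n%:R ^+ 2 *
     \sum_(U : {set 'I_n}) \sum_(F : ordgraph Sigma #|U| | boolp.asbool (Fam F))
     expect m2 c xi ch u (copyweight F).
    under eq_bigr do rewrite -expect_sum.
    rewrite -expect_sum /expect mulr_sumr -big_split /=; apply: eq_bigr => X _.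
    by rewrite /total mulrDr mulrCA.
  rewrite lerD2l ler_wpM2l ?exprn_ge0 //; apply: le_trans few_kap.
  apply: ler_sum => U _; rewrite big_mkcond; apply: ler_sum => F _.
  have sm : 0 <= delta + (#|U| ^ 2)%:R * eta by rewrite addr_ge0 ?mulr_ge0.
  case: ifP => [/boolp.asboolP FamF|_]; last first.
    by rewrite !mulr_ge0 ?exprn_ge0 ?invr_ge0 ?(ltW tau0) ?(ltW alpha0).
  rewrite /expect /copyweight.
  under eq_bigr do rewrite mulrCA.
  rewrite -mulr_sumr ler_wpM2l ?exprn_ge0 ?invr_ge0 ?(ltW tau0) //.
  apply: expect_copies; first exact: enum_val_lt.
  by apply: few => //; rewrite -[X in (_ <= X)%N]card_ord max_card.
have [u Hu] : exists u : {ffun 'I_m.+1 -> 'I_M},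
    expect m2 c xi ch u total <= n%:R ^+ 2 * (cost + kap).
  have [||u Hu] := @exists_le_mean R _
    (fun u : {ffun 'I_m.+1 -> 'I_M} => \prod_(a < m.+1) M%:R^-1)
    (fun u => expect m2 c xi ch u total).
  - by move=> u; apply: prodr_ge0 => a _; rewrite invr_ge0.
  - by have := meanu_cst m M0 (1 : R); rewrite /meanu -mulr_suml mulr1.
  - by exists u; apply: le_trans Hu mean_total.
have [||X HX] := @exists_le_mean R _
  (fun X : {ffun 'I_n -> 'I_N} => \prod_i law m2 c xi ch u i (X i)) total.
- by move=> X; apply: prodr_ge0 => i _; exact: law_ge0.
- by apply: sum_ffun_one => i; exact: law_sum.
- by exists X; apply: le_trans HX Hu.
Qed.

Lemma exists_repair : exists H' : ordgraph Sigma n,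
  family_free Fam H' /\ #|changed_pairs H H'|%:R <= n%:R ^+ 2 * (cost + kap).
Proof.
have [X HX] := exists_total.
have nR : 0 < n%:R ^+ 2 :> R by rewrite exprn_gt0 // ltr0n.
pose pickc (p : 'I_N * 'I_N) : Sigma :=
  odflt s0 [pick s | tau <= dens (ecol s0 G) c' s p].
(* Densities sum to 1 and [tau * #|Sigma|%:R <= 1], so some colour reaches [tau] and the default
   [s0] is never returned. *)
have pickP p : tau <= dens (ecol s0 G) c' (pickc p) p.
  rewrite /pickc; case: pickP => [s //|none].
  have := dens_sum (ecol s0 G) c' p => sum1.
  have : \sum_s dens (ecol s0 G) c' s p < \sum_(s : Sigma) tau.
    apply: ltr_sum; first by apply/hasP; exists s0; rewrite ?mem_index_enum.
    by move=> s _; rewrite ltNge none.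
  by rewrite sum1 sumr_const -[tau *+ _]mulr_natr ltNge tau1.
pose col i j := if tau <= dens (ecol s0 G) c' (ecol s0 H i j) (X i, X j)
  then ecol s0 H i j else pickc (X i, X j).
have colP i j : tau <= dens (ecol s0 G) c' (col i j) (X i, X j).
  by rewrite /col; case: ifP.
have cost_ge0 : 0 <= \sum_(p : 'I_n * 'I_n | (p.1 < p.2)%N)
    rare (ecol s0 H p.1 p.2) (X p.1) (X p.2).
  by apply: sumr_ge0 => p _; rewrite ler0n.
exists (mkgraph col); split.
  (* A member on [U] would have weight at least 1: it has at most [#|U| ^ 2] pairs, each of density
     at least [tau], and [tau <= 1]. Then [total X] exceeds its bound. *)
  move=> U FamU; move: HX; apply/negP; rewrite -ltNge.
  apply: (@lt_le_trans _ _ (n%:R ^+ 2 * 1)); first by rewrite ltr_pM2l.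
  rewrite /total -[leLHS]add0r lerD // ler_pM2l //.
  rewrite (bigD1 U) //= (bigD1 (osubgraph (mkgraph col) U)) /=; last exact/boolp.asboolP.
  rewrite -addrA -[leLHS]addr0 lerD //; last first.
    by rewrite addr_ge0 // sumr_ge0 // => *; rewrite ?sumr_ge0.
  have T0 : 0 < tau ^+ (#|U| ^ 2) by rewrite exprn_gt0.
  rewrite /copyweight exprVn mulrC ler_pdivlMr // mul1r.
  apply: (@le_trans _ _ (\prod_(p : 'I_#|U| * 'I_#|U| | (p.1 < p.2)%N) tau)).
    rewrite prodr_const; apply: ler_wiXn2l; rewrite ?(ltW tau0) //.
      by rewrite -invf_ge1.
    apply: leq_trans (max_card _) _.
    by rewrite card_prod card_ord mulnn.
  apply: ler_prod => -[a b] /= ab; rewrite (ltW tau0) /=.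
  by rewrite ecol_osubgraph // ecol_mkgraph ?enum_val_lt.
have le : \sum_(p : 'I_n * 'I_n | (p.1 < p.2)%N)
    rare (ecol s0 H p.1 p.2) (X p.1) (X p.2) <= total X.
  rewrite /total lerDl mulr_ge0 ?(ltW nR) // sumr_ge0 // => U _.
  by rewrite sumr_ge0.
apply: le_trans (le_trans le HX).
apply: (@le_trans _ _ #|[set p : 'I_n * 'I_n | (p.1 < p.2)%N &&
   (dens (ecol s0 G) c' (ecol s0 H p.1 p.2) (X p.1, X p.2) < tau)]|%:R).
  rewrite ler_nat -(card_imset _ (@vends_inj n)).
  apply/subset_leq_card/subsetP => _ /imsetP[e ech ->].
  have [lt ve] := vendsP e; rewrite inE lt /= ltNge; apply: contraTN ech => tle.
  by rewrite inE negbK ffunE /col tle (ecolE _ _ ve).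
rewrite -sum1_card natr_sum big_mkcond [leRHS]big_mkcond; apply: ler_sum => p _.
rewrite inE /rare; case: (p.1 < p.2)%N => //=.
by case: (dens _ _ _ _ < tau)%R; rewrite ?mulr1n ?mulr0n.
Qed.

End Repair.

(** * Energy increments *)

Lemma floor_ratio_le (R : realFieldType) (L a b d d' : nat) :
  (0 < L)%N -> (0 < d)%N -> (0 < d')%N ->
  (L * a %/ d = L * b %/ d')%N -> a%:R / d%:R <= b%:R / d'%:R + L%:R^-1 :> R.
Proof.
move=> L0 d0 d'0 E.
have H1 : (L * a < (L * b %/ d').+1 * d)%N by rewrite -E -ltn_divLR.
have H2 : (L * b %/ d' * d' <= L * b)%N by rewrite -leq_divRL.
move: H1 H2; set k := (L * b %/ d')%N.
rewrite -(ltr_nat R) -(ler_nat R) !natrM -natr1 => H1 H2.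
have [LR dR d'R] : [/\ 0 < L%:R :> R, 0 < d%:R :> R & 0 < d'%:R :> R] by rewrite !ltr0n.
rewrite -(ler_pM2l LR) mulrDr divff ?gt_eqF // !mulrA.
apply: (@le_trans _ _ (k%:R + 1)); first by rewrite ler_pdivrMr // ltW.
by rewrite lerD2r ler_pdivlMr.
Qed.

Lemma sqr_le_bin2 n : (2 <= n)%N -> (n ^ 2 <= 4 * 'C(n, 2))%N.
Proof.
move=> n2.
have : ('C(n, 2) * 2 = n * n.-1)%N.
  rewrite bin2 muln2 -[RHS]odd_double_half oddM.
  by case: n {n2} => //= n; rewrite andNb.
by case: n n2 => [//|[//|n]] _ /=; nia.
Qed.

(** This stands in for compactness: each of the finitely many indices that is realised gets one
    witness, and [M] is the largest of these. *)
Lemma bounded_witness (I : finType) (P : I -> nat -> Prop) :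
  exists M, forall i, (exists n, P i n) -> exists n, (n <= M)%N /\ P i n.
Proof.
have ex i : exists k, (exists n, P i n) -> P i k.
  by have [[n Pn]|no] := boolp.pselect (exists n, P i n); [exists n | exists 0%N].
have [f Hf] := boolp.choice ex.
exists (\max_i f i)%N => i /Hf Pf; exists (f i); split => //.
exact: leq_bigmax.
Qed.

Lemma bounded_above (R : realFieldType) (f : nat -> R) (M : nat) :
  exists B, 0 < B /\ forall n, (n <= M)%N -> f n <= B.
Proof.
elim: M => [|M [B [B0 HB]]].
  exists (1 + `|f 0%N|); split=> [|n]; first by rewrite ltr_wpDr.
  by rewrite leqn0 => /eqP->; rewrite ler_wpDl // ler_norm.
exists (B + `|f M.+1|); split=> [|n]; first by rewrite ltr_wpDr.
rewrite leq_eqVlt ltnS => /orP[/eqP->|/HB le]; last by rewrite ler_wpDr.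
by apply: le_trans (ler_norm _) _; rewrite lerDr ltW.
Qed.

(** * Choice of constants and the nested increments *)

Section Testing.
Context {R : realType} {Sigma : finType}.
Variables (s0 : Sigma) (Fam : graph_family Sigma) (eps : R).
Hypothesis eps0 : 0 < eps.
Hypothesis eps1 : eps <= 1.

Definition many (q0 : nat) (delta : R) (n : nat) (G : ordgraph Sigma n) :=
  exists (q : nat) (F : ordgraph Sigma q),
    [/\ Fam F, (q <= q0)%N & delta * n%:R ^+ q <= #|induced_copies F G|%:R].

Lemma many_mono q0 q1 d0 d1 n (G : ordgraph Sigma n) :
  (q0 <= q1)%N -> d1 <= d0 -> many q0 d0 G -> many q1 d1 G.
Proof.
move=> q01 d10 [q [F [FF qq le]]]; exists q, F; split => //.
  exact: leq_trans q01.
by apply: le_trans le; rewrite ler_wpM2r ?exprn_ge0.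
Qed.

(** For bounded [n] a single copy suffices, because [delta * n%:R ^+ q <= 1]. *)
Lemma many_small (N1 : nat) : exists2 delta : R, 0 < delta &
  forall n (G : ordgraph Sigma n), (n <= N1)%N -> ~ family_free Fam G -> many N1 delta G.
Proof.
have P0 : 0 < N1.+1%:R ^+ N1 :> R by rewrite exprn_gt0 ?ltr0n.
exists (N1.+1%:R ^+ N1)^-1; first by rewrite invr_gt0.
move=> n G nN nfree.
have [U FU] : exists U : {set 'I_n}, Fam (osubgraph G U).
  by apply: boolp.contrapT => no; apply: nfree => U FU; apply: no; exists U.
have Un : (#|U| <= n)%N by rewrite -[X in (_ <= X)%N]card_ord max_card.
exists #|U|, (osubgraph G U); split => //; first exact: leq_trans Un nN.
apply: (@le_trans _ _ 1).
  rewrite mulrC ler_pdivrMr // mul1r.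
  apply: (@le_trans _ _ (N1.+1%:R ^+ #|U|)).
    by rewrite lerXn2r ?nnegrE ?ler0n // ler_nat (leq_trans nN).
  by apply: ler_weXn2l; [rewrite ler1n | exact: leq_trans Un nN].
by rewrite ler1n; apply/card_gt0P; exists U; rewrite inE.
Qed.

Definition rho_energy (K : finType) (m N : nat) (c : 'I_N -> K) : R :=
  \sum_b energy (@pos m N) (colour_ind c b).

Let S : R := #|Sigma|%:R.
(** The recolouring threshold. Both [2 * a * S] and [gap / a] equal [eps / 8192]; the factor 64 in
    [table_cost] turns their sum into [eps / 64]. *)
Let a : R := eps / (16384 * S).
Let gap : R := a * (eps / 8192).
(** Likewise for the colour frequencies: two shares of [eps / 10240], multiplied by 80 in
    [table_cost], make [eps / 64]. *)
Let rgap (K : finType) : R :=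
  (eps / (10240 * #|K|.+1%:R)) * (eps / 10240).

Let S1 : 1 <= S.
Proof. by rewrite ler1n; apply/card_gt0P; exists s0. Qed.

Let S0 : 0 < S. Proof. exact: lt_le_trans ltr01 S1. Qed.

Let a0 : 0 < a. Proof. by rewrite divr_gt0 // mulr_gt0. Qed.

Let gap0 : 0 < gap. Proof. by rewrite mulr_gt0 // divr_gt0. Qed.

Let rgap0 K : 0 < rgap K.
Proof. by rewrite mulr_gt0 // divr_gt0 // mulr_gt0. Qed.

(** Where the density for [c'] is below [a], the coarser density is at most [a] plus their
    difference. The differences are small in L1 because [cell m c] lies between [c] and [c'], whose
    energies differ by at most [gap]. *)
Lemma rare_mass (K K' : finType) (m N : nat) (c : 'I_N -> K) (c' : 'I_N -> K')
    (G : ordgraph Sigma N) :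
  (0 < N)%N -> refines c' (cell m c) ->
  pair_energy (ecol s0 G) c' - pair_energy (ecol s0 G) c <= gap ->
  (\sum_s \sum_p dens (ecol s0 G) (cell m c) s p * rare s0 c' G a s p.1 p.2) / N%:R ^+ 2
  <= eps / 4096 :> R.
Proof.
move=> N0 ref small; set g := ecol s0 G.
have NR : 0 < N%:R ^+ 2 :> R by rewrite exprn_gt0 // ltr0n.
have cN : #|{: 'I_N * 'I_N}|%:R = N%:R ^+ 2 :> R.
  by rewrite card_prod card_ord natrM expr2.
have rcell : refines (cell m c) c by move=> x y [].
have term s : \sum_p dens g (cell m c) s p * rare s0 c' G a s p.1 p.2 <=
   (2 * a + (energy (pcol c') (has_col g s) -
             energy (pcol (cell m c)) (has_col g s)) / a) * N%:R ^+ 2.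
  have := l1_le_energy (has_col g s) a0 (refines_pcol ref); rewrite cN => H.
  apply: (@le_trans _ _ (\sum_p (`|dens g c' s p - dens g (cell m c) s p| + a))).
    apply: ler_sum => -[x y] _ /=; rewrite /rare -/g.
    have d0 := dens_ge0 g (cell m c) s (x, y) : 0 <= _ :> R.
    have : dens g (cell m c) s (x, y) - dens g c' s (x, y) <=
           `|dens g c' s (x, y) - dens g (cell m c) s (x, y)| :> R.
      by rewrite distrC ler_norm.
    case: ltP => /= lt; rewrite ?mulr1n ?mulr1 ?mulr0.
      by move: lt; lra.
    by move=> _; rewrite addr_ge0 // ltW.
  rewrite big_split /= sumr_const -[a *+ _]mulr_natr cN.
  by move: H; rewrite /dens; lra.
rewrite ler_pdivrMr //; apply: le_trans; first by apply: ler_sum => i _; exact: (term i).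
rewrite -mulr_suml ler_pM2r // big_split /= sumr_const -[_ *+ _]mulr_natr -/S.
rewrite -mulr_suml sumrB -/(pair_energy g c') -/(pair_energy g (cell m c)).
have mono := pair_energy_mono g rcell : pair_energy _ _ <= pair_energy _ _ :> R.
have : (pair_energy g c' - pair_energy g (cell m c)) / a <= eps / 8192.
  rewrite ler_pdivrMr // [leRHS]mulrC -/gap; move: small mono; lra.
have -> : 2 * a * S = eps / 8192 by rewrite /a; field; rewrite gt_eqF.
lra.
Qed.

Lemma rho_small (K : finType) (m d m2 N : nat) (c : 'I_N -> K) :
  (0 < N)%N -> (0 < d)%N -> m2.+1 = (m.+1 * d)%N ->
  rho_energy m2 c - rho_energy m c <= rgap K ->
  (\sum_b \sum_v `|cexp (@pos m2 N) (colour_ind c b) v -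
                   cexp (@pos m N) (colour_ind c b) v|) / N%:R <= eps / 5120 :> R.
Proof.
move=> N0 d0 m2E small.
have NR : 0 < N%:R :> R by rewrite ltr0n.
pose a' : R := eps / (10240 * #|K|.+1%:R).
have a'0 : 0 < a' by rewrite divr_gt0 // mulr_gt0.
have term b : \sum_v `|cexp (@pos m2 N) (colour_ind c b) v -
                   cexp (@pos m N) (colour_ind c b) v| <=
  (a' + (energy (@pos m2 N) (colour_ind c b) -
         energy (@pos m N) (colour_ind c b)) / a') * N%:R.
  have := l1_le_energy (colour_ind c b) a'0 (@pos_refines m d m2 N d0 m2E).
  by rewrite card_ord.
rewrite ler_pdivrMr //; apply: le_trans; first by apply: ler_sum => i _; exact: (term i).
rewrite -mulr_suml ler_pM2r // big_split /= sumr_const -[_ *+ _]mulr_natr.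
rewrite -mulr_suml sumrB -/(rho_energy m2 c) -/(rho_energy m c).
have : (rho_energy m2 c - rho_energy m c) / a' <= eps / 10240.
  by rewrite ler_pdivrMr // [leRHS]mulrC.
have : a' * #|K|%:R <= eps / 10240.
  have -> : eps / 10240 = a' * #|K|.+1%:R.
    have x0 : #|K|.+1%:R != 0 :> R by rewrite pnatr_eq0.
    by rewrite /a'; move: (_.+1%:R) x0 => x x0; field.
  by rewrite ler_pM2l // ler_nat.
lra.
Qed.

(** Frequencies of cells and of types of pairs, rounded down to multiples of [1 / L]. They range
    over a finite type, which is what bounds the size of the substitute [H]. *)
Definition table (K : finType) (m L n : nat) (H : ordgraph Sigma n) (ch : 'I_n -> K) :
  {ffun K * 'I_m.+1 -> 'I_L.+1} *
  {ffun Sigma * (K * 'I_m.+1) * (K * 'I_m.+1) -> 'I_L.+1} :=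
  ([ffun q => inord (L * #|cells ch q| %/ n)],
   [ffun t => inord (L * #|[set p | triple (ecol s0 H) (cell m ch) p == t]| %/ n ^ 2)]).

Lemma table_close (K : finType) (m L n N : nat) (H : ordgraph Sigma n) (ch : 'I_n -> K)
    (G : ordgraph Sigma N) (c : 'I_N -> K) :
  (0 < L)%N -> (0 < n)%N -> (0 < N)%N -> table m L H ch = table m L G c ->
  (forall q : K * 'I_m.+1,
     #|cells ch q|%:R / n%:R <= #|cells c q|%:R / N%:R + L%:R^-1 :> R) /\
  (forall t : Sigma * (K * 'I_m.+1) * (K * 'I_m.+1),
     #|[set p | triple (ecol s0 H) (cell m ch) p == t]|%:R / n%:R ^+ 2 <=
     #|[set p | triple (ecol s0 G) (cell m c) p == t]|%:R / N%:R ^+ 2 + L%:R^-1 :> R).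
Proof.
move=> L0 n0 N0 [E1 E2].
have cell_le k (f : 'I_k -> K) (q : K * 'I_m.+1) : (0 < k)%N ->
    (L * #|cells f q| %/ k < L.+1)%N.
  move=> k0; rewrite ltn_divLR //; apply: (@leq_ltn_trans (L * k)); last by rewrite ltn_pmul2r.
  by rewrite leq_mul2l -[X in (_ <= X)%N]card_ord max_card orbT.
have trip_le k (f : 'I_k -> K) (F : ordgraph Sigma k) t : (0 < k)%N ->
    (L * #|[set p | triple (ecol s0 F) (cell m f) p == t]| %/ k ^ 2 < L.+1)%N.
  move=> k0; rewrite ltn_divLR ?expn_gt0 ?k0 //.
  apply: (@leq_ltn_trans (L * k ^ 2)); last by rewrite ltn_pmul2r ?expn_gt0 ?k0.
  rewrite leq_mul2l; apply/orP; right; apply: leq_trans (max_card _) _.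
  by rewrite card_prod card_ord mulnn.
split=> [q|t].
  apply: floor_ratio_le => //.
  have /(congr1 val) := congr1 (fun f : {ffun _ -> _} => f q) E1.
  by rewrite /= !ffunE !inordK // cell_le.
rewrite -!natrX; apply: floor_ratio_le; rewrite ?expn_gt0 ?n0 ?N0 //.
have /(congr1 val) := congr1 (fun f : {ffun _ -> _} => f t) E2.
by rewrite /= !ffunE !inordK // trip_le.
Qed.

(** The case where both energies are stable. The bound [M] is fixed first and [eta] after it, so
    [c'] may be far more regular than the size of [H] demands. *)
Lemma core (K : finType) (m : nat) : m.+1%:R^-1 <= eps / 64 ->
  exists (M : nat) (eta delta : R) (N1 : nat),
  [/\ (0 < M)%N, 0 < eta, 0 < delta &
  forall (N : nat) (G : ordgraph Sigma N) (c : 'I_N -> K) (K' : finType) (c' : 'I_N -> K'),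
    (N1 <= N)%N -> eps_far Fam eps G ->
    rho_energy (m.+1 * (2 * M)).-1 c - rho_energy m c <= rgap K ->
    refines c' (cell m c) -> cut_regular (ecol s0 G) c' eta ->
    pair_energy (ecol s0 G) c' - pair_energy (ecol s0 G) c <= gap ->
    many M delta G].
Proof.
move=> hm.
pose n1 := (Num.bound (64 / eps)).+2.
have n1P n : (n1 <= n)%N -> n%:R^-1 <= eps / 64 /\ (2 <= n)%N.
  move=> le; split; last by apply: leq_trans le.
  have n0 : (0 < n)%N by apply: leq_trans le.
  rewrite -[eps / 64]invrK invf_div lef_pV2 ?posrE ?divr_gt0 ?ltr0n //.
  apply: (@le_trans _ _ n1%:R); last by rewrite ler_nat.
  apply: le_trans (ltW (archi_boundP (ltW (divr_gt0 _ eps0)))) _ => //.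
  by rewrite ler_nat /n1 (leq_trans (leqnSn _)).
pose k : R := #|K|%:R.
pose c1 : R := #|{: K * 'I_m.+1}|%:R.
pose c2 : R := #|{: Sigma * (K * 'I_m.+1) * (K * 'I_m.+1)}|%:R.
pose L := (Num.bound ((20 * c1 + 64 * c2) / (eps / 64))).+1.
have L0 : 0 < L%:R :> R by rewrite ltr0n.
have e64 : 0 < eps / 64 by rewrite divr_gt0.
have LP : (20 * c1 + 64 * c2) / L%:R <= eps / 64.
  rewrite ler_pdivrMr // [leRHS]mulrC -ler_pdivrMr //.
  apply: le_trans (ltW (archi_boundP _)) _; last by rewrite ler_nat.
  by apply: divr_ge0 (ltW e64); rewrite addr_ge0 ?mulr_ge0 ?ler0n.
pose xi : R := eps / (2560 * #|K|.+1%:R).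
have k1 : 1 <= #|K|.+1%:R :> R by rewrite ler1n.
have kk : 0 < 2560 * #|K|.+1%:R :> R by rewrite mulr_gt0 // ltr0n.
have xi0 : 0 < xi by rewrite divr_gt0.
have xi1 : xi <= 1.
  by rewrite ler_pdivrMr //; move: eps1 k1; lra.
have xiP : 40 * (xi * k) <= eps / 64.
  have -> : eps / 64 = 40 * (xi * #|K|.+1%:R).
    have x0 : #|K|.+1%:R != 0 :> R by rewrite pnatr_eq0.
    by rewrite /xi; move: (_.+1%:R) x0 => x x0; field.
  by rewrite ler_pM2l // ler_pM2l // ler_nat.
(* The graph [G] itself realises its own table, so [bounded_witness] yields a far [H] with that
   table and at most [M0] vertices. *)
pose P t n := exists (H : ordgraph Sigma n) (ch : 'I_n -> K),
  [/\ (n1 <= n)%N, eps_far Fam eps H & table m L H ch = t].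
have [M0 HM0] := bounded_witness P.
pose M := M0.+1.
pose m2 := (m.+1 * (2 * M)).-1.
have m2E : m2.+1 = (m.+1 * (2 * M))%N by rewrite prednK // !muln_gt0.
pose alpha : R := xi / (4 * m2.+1%:R).
(* The bound of [exists_repair] on forbidden copies with [eta] factored out. It involves [alpha],
   hence [M], which forces [eta] to come later. *)
pose f n : R := \sum_(U : {set 'I_n}) \sum_(F : ordgraph Sigma #|U|)
    a^-1 ^+ (#|U| ^ 2) * (alpha^-1 ^+ #|U| * (1 + (#|U| ^ 2)%:R)).
have [B [B0 HB]] := bounded_above f M.
pose eta : R := eps / 64 / B.
have eta0 : 0 < eta by rewrite divr_gt0.
(* The same [eta] serves as cut-regularity precision and as copy density. *)
exists M; exists eta; exists eta; exists (maxn n1 (4 * m2.+1))%N; split => //.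
move=> N G c K' c' NN farG rho ref reg small.
have [n1N m2N] : (n1 <= N)%N /\ (4 * m2.+1 <= N)%N by move: NN; rewrite geq_max => /andP.
have [n [nM0 [H [ch [n1n farH tabE]]]]] := HM0 (table m L G c)
  (ex_intro _ N (ex_intro _ G (ex_intro _ c (And3 n1N farG erefl)))).
have nM : (n <= M)%N by rewrite leqW.
apply: boolp.contrapT => nmany.
have [nV n2] := n1P n n1n.
have n0 : (0 < n)%N by apply: leq_trans n2.
have N0 : (0 < N)%N by apply: leq_trans m2N; rewrite muln_gt0.
have [HQ HT] := table_close (isT : (0 < L)%N) n0 N0 tabE.
have few q (F : ordgraph Sigma q) : (q <= n)%N -> Fam F ->
    #|induced_copies F G|%:R <= eta * N%:R ^+ q.
  move=> qn FamF; rewrite leNgt; apply/negP => lt; apply: nmany.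
  by exists q, F; split => //; [exact: leq_trans qn nM | exact: ltW].
have rare01 s x y : 0 <= rare s0 c' G a s x y <= 1.
  by rewrite ler0n lern1 leq_b1.
have cost := @table_cost R Sigma K m M m2 N n c ch xi L%:R^-1 (ecol s0 G) (ecol s0 H)
  (rare s0 c' G a) (ltn0Sn _) m2E m2N xi0 xi1 _ nM n0 rare01 HQ HT.
have {cost} := cost (_ : 0 <= L%:R^-1); rewrite invr_ge0 ltW // => /(_ isT).
set C := (X in _ <= _ * X) => cost.
(* Six shares of [eps / 64]: same-interval pairs (two), frequency changes, [xi], rounding by [L],
   and rare colours. The copies add one more below. *)
have CP : C <= 7 * (eps / 64).
  have Hrho := @rho_small K m (2 * M) m2 N c N0 isT m2E rho.
  have Hrare := @rare_mass K K' m N c c' G N0 ref small.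
  rewrite /C -/k -/c1 -/c2; move: Hrho Hrare; set D := _ / N%:R; set E := _ / N%:R ^+ 2.
  move: nV hm xiP LP.
  set x := m.+1%:R^-1; set y := n%:R^-1; set z := L%:R^-1.
  lra.
have a1 : a * #|Sigma|%:R <= 1.
  by rewrite /a -/S; move: S0 => SS; rewrite invfM mulrA divfK ?gt_eqF //; move: eps1; lra.
have kap : \sum_(U : {set 'I_n}) \sum_(F : ordgraph Sigma #|U|)
    a^-1 ^+ (#|U| ^ 2) * (alpha^-1 ^+ #|U| * (eta + (#|U| ^ 2)%:R * eta)) <= eps / 64.
  have -> : eps / 64 = eta * B by rewrite /eta divfK // gt_eqF.
  apply: le_trans (_ : eta * f n <= _); last by rewrite ler_pM2l // HB.
  rewrite /f mulr_sumr; apply: ler_sum => U _; rewrite mulr_sumr; apply: ler_sum => F _.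
  by rewrite le_eqVlt; apply/orP; left; apply/eqP; ring.
have [|H' [free close]] := @exists_repair R Sigma K K' s0 Fam m M m2 N n c c' ch G H xi eta eta
  (ltn0Sn _) m2E m2N xi0 xi1 nM (ltW eta0) reg a C (eps / 64) a0 a1 few kap (ltW eta0) n0 cost.
  by move: CP eps1; lra.
have [_ /(_ H' free)] := farH; apply/negP; rewrite -ltNge.
apply: le_lt_trans close _.
have C2 : n%:R ^+ 2 <= 4 * 'C(n, 2)%:R :> R.
  by rewrite -natrX -natrM ler_nat sqr_le_bin2.
have n2R : 0 < n%:R ^+ 2 :> R by rewrite exprn_gt0 // ltr0n.
(* The repair costs at most [eps / 8] per [n%:R ^+ 2], while [n ^ 2] is at most four times the
   number of pairs. *)
apply: (@lt_le_trans _ _ (n%:R ^+ 2 * (eps / 4))).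
  by rewrite ltr_pM2l //; move: CP eps0; lra.
have := ler_wpM2l (ltW e64) C2; move: (n%:R ^+ 2) => z; lra.
Qed.

(** [d] bounds the increments of pair energy still possible. The constants may depend on the palette
    [K] but not on [G] or [c]. *)
Definition outer (d : nat) := forall K : finType, exists q0 delta, 0 < delta /\
  forall N (G : ordgraph Sigma N) (c : 'I_N -> K), eps_far Fam eps G ->
    #|Sigma|.+1%:R - d%:R * gap <= pair_energy (ecol s0 G) c -> many q0 delta G.

(** Here [d'] bounds the remaining increments of [rho_energy] with the colouring kept. A jump of
    that energy refines the intervals and uses the induction on [d']; a jump of pair energy passes
    to the finer palette and to [outer d]; with no jump [core] applies. *)
Lemma inner (d : nat) (K : finType) (d' m : nat) : outer d -> m.+1%:R^-1 <= eps / 64 ->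
  exists q0 delta, 0 < delta /\
  forall N (G : ordgraph Sigma N) (c : 'I_N -> K), eps_far Fam eps G ->
    #|Sigma|.+1%:R - d.+1%:R * gap <= pair_energy (ecol s0 G) c ->
    #|K|.+1%:R - d'%:R * rgap K <= rho_energy m c -> many q0 delta G.
Proof.
move=> Hout; elim: d' m => [|d' IH] m hm.
  exists 0%N; exists 1; split => // N G c _ _; rewrite mul0r subr0 => le; exfalso.
  have : rho_energy m c <= #|K|%:R.
    rewrite -sum1_card natr_sum; apply: ler_sum => b _; apply: energy_le1 => v.
    by rewrite ler0n lern1 leq_b1.
  by move=> /(le_trans le); rewrite ler_nat ltnn.
have [M [eta [delta [N1 [M0 eta0 delta0 Hcore]]]]] := core K hm.
pose m2 := (m.+1 * (2 * M)).-1.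
have m2E : m2.+1 = (m.+1 * (2 * M))%N by rewrite prednK // !muln_gt0 M0.
have hm2 : m2.+1%:R^-1 <= eps / 64.
  apply: le_trans hm; rewrite lef_pV2 ?posrE ?ltr0n // ler_nat m2E.
  by rewrite leq_pmulr // muln_gt0 M0.
have [q1 [d1 [d10 H1]]] := IH m2 hm2.
have [K' HK'] := exists_cut_regular Sigma eta0 (K * 'I_m.+1)%type.
have [q2 [d2 [d20 H2]]] := Hout K'.
have [d3 d30 H3] := many_small N1.
(* One pair of constants must cover all four outcomes, since which one occurs depends on [G]. *)
exists (M + q1 + q2 + N1)%N.
exists (Num.min (Num.min delta d1) (Num.min d2 d3)).
split; first by rewrite !lt_min delta0 d10 d20 d30.
move=> N G c far Ec Rc.
have [NN|NN] := leqP N N1.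
  apply: (@many_mono N1 _ d3); [exact: leq_addl | by rewrite !ge_min lexx !orbT |].
  by apply: H3 => //; case: far.
have [rle|rlt] := lerP (rho_energy m2 c - rho_energy m c) (rgap K); last first.
  apply: (@many_mono q1 _ d1); [by clear; lia | by rewrite !ge_min lexx !orbT |].
  apply: (H1 N G c far Ec).
  by move: Rc rlt; rewrite -[d'.+1%:R]natr1; lra.
have [c' [ref reg]] := HK' _ (ecol s0 G) (cell m c).
have [ele|elt] := lerP (pair_energy (ecol s0 G) c' - pair_energy (ecol s0 G) c) gap.
  apply: (@many_mono M _ delta); [by clear; lia | by rewrite !ge_min lexx |].
  exact: (Hcore N G c K' c' (ltnW NN) far rle ref reg ele).
apply: (@many_mono q2 _ d2); [by clear; lia | by rewrite !ge_min lexx !orbT |].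
apply: (H2 N G c' far).
by move: Ec elt; rewrite -[d.+1%:R]natr1; lra.
Qed.

Lemma outer_all d : outer d.
Proof.
elim: d => [|d IH] K.
  exists 0%N; exists 1; split => // N G c _; rewrite mul0r subr0 => le; exfalso.
  have := le_trans le (pair_energy_le (ecol s0 G) c).
  by rewrite ler_nat ltnn.
pose m := Num.bound (64 / eps).
have hm : m.+1%:R^-1 <= eps / 64.
  rewrite -[eps / 64]invrK invf_div lef_pV2 ?posrE ?divr_gt0 ?ltr0n //.
  apply: le_trans (ltW (archi_boundP (ltW (divr_gt0 _ eps0)))) _ => //.
  by rewrite ler_nat.
pose d' := Num.bound (#|K|.+1%:R / rgap K).
have [q0 [delta [delta0 H]]] := inner K d' IH hm.
exists q0; exists delta; split => // N G c far Ec; apply: (H N G c far Ec).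
apply: (@le_trans _ _ 0).
  rewrite subr_le0 -ler_pdivrMr //; apply/ltW/archi_boundP.
  by rewrite divr_ge0 // ltW.
apply: sumr_ge0 => b _; rewrite divr_ge0 ?ler0n ?sumr_ge0 // => x _.
exact: sqr_ge0.
Qed.

Lemma far_many : exists (q0 : nat) (delta : R), 0 < delta /\
  forall n (G : ordgraph Sigma n), eps_far Fam eps G -> many q0 delta G.
Proof.
(* Start from the trivial colouring, with enough increments for the energy threshold to be
   nonpositive. *)
pose d := Num.bound (#|Sigma|.+1%:R / gap).
have [q0 [delta [delta0 H]]] := outer_all d unit.
exists q0; exists delta; split => // n G far; apply: (H n G (fun=> tt) far).
apply: (@le_trans _ _ 0).
  rewrite subr_le0 -ler_pdivrMr //; apply/ltW/archi_boundP.
  by rewrite divr_ge0 // ltW.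
apply: sumr_ge0 => s _; rewrite divr_ge0 ?ler0n ?sumr_ge0 // => x _.
exact: sqr_ge0.
Qed.

End Testing.

Local Close Scope ring_scope.

Theorem theorem1p6 (R : realType) (Sigma : finType) (card_Sigma : 2 <= #|Sigma|)
    (Fam : graph_family Sigma) (eps : R) (eps_gt0 : (0 < eps)%R) :
  exists (q0 : nat) (delta : R), (0 < delta)%R /\
    forall (n : nat) (G : ordgraph Sigma n), eps_far Fam eps G ->
      exists (q : nat) (F : ordgraph Sigma q),
        [/\ Fam q F, q <= q0 &
            (delta * n%:R ^+ q <= #|induced_copies F G|%:R)%R].
Proof.
have /card_gt0P[s0 _] : 0 < #|Sigma| by apply: leq_trans card_Sigma.
(* Being far for [eps] implies being far for any smaller value, so [eps] may be capped at 1. *)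
have e0 : (0 < Num.min eps 1)%R by rewrite lt_min eps_gt0 ltr01.
have e1 : (Num.min eps 1 <= 1)%R by rewrite ge_min lexx orbT.
have [q0 [delta [delta0 H]]] := far_many s0 Fam e0 e1.
exists q0; exists delta; split => // n G [nfree far]; apply: H; split => // H' free.
by apply: le_trans (far H' free); rewrite ler_wpM2r // ge_min lexx.
Qed.
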